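(* Let $r\geq 2$ be a fixed integer, let $k=k(n)\geq 2$ be an integer, and assume $n\geq r(k+\tfrac12)$. Write $$p_c=\frac{\ln\left(\binom{n}{r-1}\binom{n-r+1}{k}\right)}{\prod_{i=1}^{r-1}\binom{n-ik-(r-i)}{k-1}} .$$ All limits are taken as $n\to\infty$. (I) There are positive constants $\zeta=\zeta(r)$ and $C=C(r)$ such that, if $p=p(n)>\zeta p_c$ and $k\leq C n^{1/7}$ (when $r\in\{2,3\}$, it suffices that $k=o(n^{1/3})$), then $$\mathbb{P}\left(\alpha\left(\operatorname{KG}^r_{n,k}(p)\right)=\binom{n}{k}-\binom{n-r+1}{k}\right)\to 1.$$ Furthermore, with probability tending to $1$, the only independent sets of $\operatorname{KG}^r_{n,k}(p)$ of size $\binom{n}{k}-\binom{n-r+1}{k}$ are the unions of $r-1$ distinct stars. (II) For each $\varepsilon\in(0,1]$, if $p\leq (1-\varepsilon)p_c$, then $$\mathbb{P}\left(\alpha\left(\operatorname{KG}^r_{n,k}(p)\right)=\binom{n}{k}-\binom{n-r+1}{k}\right)\to 0.$$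
   Context: $[n]=\{1,\dots,n\}$ and $\binom{[n]}{k}$ denotes the family of all $k$-element subsets of $[n]$. The Kneser hypergraph $\operatorname{KG}^r_{n,k}$ is the $r$-uniform hypergraph with vertex set $\binom{[n]}{k}$ whose edges are the sets $\{A_1,\dots,A_r\}$ of $r$ pairwise disjoint members of $\binom{[n]}{k}$. The random Kneser hypergraph $\operatorname{KG}^r_{n,k}(p)$ is the spanning subhypergraph of $\operatorname{KG}^r_{n,k}$ in which each edge of $\operatorname{KG}^r_{n,k}$ is retained independently with probability $p$. An independent set of a hypergraph is a set of vertices containing no edge, and $\alpha(\cdot)$ denotes the maximum size of an independent set. For $x\in[n]$, the star $\mathcal{S}_x$ is $\{A\in\binom{[n]}{k}: x\in A\}$.
   Formalization: Part (II) additionally assumes p ≤ 1−exp(−(1−ε)p_c) whenever p_c > 1 (for large n this occurs only if r=2, n=2k+1); as stated it fails there: with ε=1/4, p=1 is allowed and the equality holds by Erdős–Ko–Rado. *)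

(* Defs.v *)
From HB Require Import structures.
From mathcomp Require Import all_boot all_order all_algebra.
From mathcomp Require Import all_classical all_reals all_analysis.
Set Implicit Arguments.
Unset Strict Implicit.
Unset Printing Implicit Defensive.
Import Order.TTheory GRing.Theory Num.Theory.
Import numFieldNormedType.Exports.
Local Open Scope ring_scope.

Section Hypergraph.
Variables (T : finType) (V : {set T}) (E : {set {set T}}).

Definition independent (S : {set T}) : bool :=
  (S \subset V) && [forall e in E, ~~ (e \subset S)].

Definition alpha : nat :=
  (\max_(S : {set T} | independent S) #|S|)%N.

End Hypergraph.

(* The ground set {1, ..., n} is represented by 'I_n. *)
Definition ksubsets (n k : nat) : {set {set 'I_n}} :=
  [set A : {set 'I_n} | #|A| == k]%SET.

(* For k >= 1 distinct members of a [trivIset] family of k-sets are exactly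
   pairwise disjoint k-sets. *)
Definition kneser_edges (r n k : nat) : {set {set {set 'I_n}}} :=
  [set e : {set {set 'I_n}} |
     [&& e \subset ksubsets n k, #|e| == r & finset.trivIset e]]%SET.

Definition star (n k : nat) (x : 'I_n) : {set {set 'I_n}} :=
  [set A : {set 'I_n} in ksubsets n k | x \in A]%SET.

(* Probability of the event P H, where H is the random subset of E containing
   each element of E independently with probability p. *)
Definition random_subset_pr (R : realType) (T : finType) (E : {set T}) (p : R)
    (P : pred {set T}) : R :=
  \sum_(H : {set T} | (H \subset E) && P H)
     \prod_(e in E) (if e \in H then p else 1 - p).

Lemma random_subset_pr_sup (R : realType) (T : finType) (A E : {set T}) (p : R) :
  A \subset E ->
  random_subset_pr E p (fun H => A \subset H) = p ^+ #|A|.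
Proof.
move=> sAE.
pose F (e : T) : R := if e \in E then p else 0.
pose G (e : T) : R := if e \in E then (if e \in A then 0 else 1 - p) else 1.
have := @bigA_distr R 0 1 *%R +%R T F G.
have -> : \prod_e (F e + G e) = p ^+ #|A|.
  rewrite (bigID (mem A)) /= [X in _ * X]big1 ?mulr1.
    rewrite -prodr_const; apply: eq_bigr => e eA.
    by rewrite /F /G (fintype.subsetP sAE) // eA addr0.
  move=> e /negbTE eA; rewrite /F /G eA; case: ifP => _.
    by rewrite addrC subrK.
  by rewrite add0r.
move=> ->.
rewrite /random_subset_pr [RHS](bigID (fun H : {set T} => (H \subset E) && (A \subset H))) /=.
rewrite [X in _ = _ + X]big1 ?addr0.
  apply: eq_bigr => H /andP[sHE sAH].
  rewrite [RHS](bigID (mem E)) /= [X in _ = _ * X]big1 ?mulr1.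
    apply: eq_bigr => e eE; rewrite /F /G eE; case: ifP => // eH.
    case: ifP => // eA; by rewrite (fintype.subsetP sAH) in eH.
  move=> e eE; rewrite /F /G (negbTE eE); case: ifP => // eH.
  by rewrite (fintype.subsetP sHE) in eE.
move=> H; rewrite negb_and => /orP[] /fintype.subsetPn[e e1 e2];
  rewrite (bigD1 e) //= /F /G; first by rewrite e1 (negbTE e2) mul0r.
by rewrite (negbTE e2) (fintype.subsetP sAE) // e1 mul0r.
Qed.

(* Probability that the edge set H of the random Kneser hypergraph satisfies
   P; its vertex set is always [ksubsets n k]. *)
Definition random_kneser_pr (R : realType) (r n k : nat) (p : R)
    (P : pred {set {set {set 'I_n}}}) : R :=
  random_subset_pr (kneser_edges r n k) p P.

Arguments random_kneser_pr {R} r n k p P.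

Definition star_size (r n k : nat) : nat := ('C(n, k) - 'C(n - r + 1, k))%N.

Definition alpha_is_star_size (r n k : nat) (H : {set {set {set 'I_n}}}) : bool :=
  alpha (ksubsets n k) H == star_size r n k.

Definition only_star_unions (r n k : nat) (H : {set {set {set 'I_n}}}) : bool :=
  [forall S : {set {set 'I_n}},
     independent (ksubsets n k) H S && (#|S| == star_size r n k) ==
     [exists X : {set 'I_n},
        (#|X| == (r - 1)%N) && (S == (\bigcup_(x in X) star k x)%SET)]].

Arguments alpha_is_star_size r n k H : clear implicits.
Arguments only_star_unions r n k H : clear implicits.

(* The subtractions are on nat; none of them truncates when 2 <= r, 1 <= k and
   r * (k + 1/2) <= n. *)
Definition critical_p (R : realType) (r n k : nat) : R :=
  ln (('C(n, r - 1) * 'C(n - r + 1, k))%N%:R : R)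
  / (\prod_(1 <= i < r) 'C(n - i * k - (r - i), k - 1))%N%:R.

(* Main.v *)
(** Write [s = r - 1], [T = 'C(n - 1, k - 1)] for the size of a star, [N] and
    [D] for the argument of the logarithm and for the denominator in
    [critical_p].

    Above the threshold, the point is a supersaturation inequality, valid as
    soon as [n >= (24 r)^3 k^3]: a family [F] of k-sets of the size of a union
    of [s] stars satisfies [b * T ^ s <= Gamma * e(F)] for some union of [s]
    stars from which [F] differs by [b] sets each way, where [e(F)] is the
    number of edges inside [F].  If [s] points have degree at least [T / (24 r)]
    in [F], each set of [F] avoiding them extends greedily to many edges, two
    stars sharing at most [T k / n] sets.  Otherwise, the at most [s - 1] such
    points leave at least [T / 2] sets of small degrees, and bounded codegrees
    force most pairs of these sets to be disjoint.  As [D <= T ^ s], such an [F]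
    is independent with probability at most [N ^ (- 6 b)], which beats the
    number of families at distance [b] from a union of stars.

    Below the threshold, adding to a union of [s] stars centered in [X] a k-set
    [A] disjoint from [X] destroys independence through [D] edges.  Confine [X]
    to a fixed set [U] and [A] to its complement: distinct [A] then give disjoint
    sets of edges, and a second moment computation finds a pair [(X, A)] none of
    whose [D] edges is retained.  For large [k] the set [U] has size [s]; for
    bounded [k] it is half of the ground set and, by symmetry, two distinct [X]
    share a fraction [O(1 / n)] of the edges at a given [A].  Finally
    [critical_p] is either small or greater than 1, the latter only for [r = 2]
    and [n = 2 k + 1]. *)
Require Import Defs.
From HB Require Import structures.
From mathcomp Require Import all_boot fingroup perm zify.
Set Implicit Arguments.
Unset Strict Implicit.
Unset Printing Implicit Defensive.

(** * Packings in a uniform family *)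

Section Packings.
Variable U : finType.
Implicit Types (F G g e : {set {set U}}) (A B Z : {set U}) (x y : U).

(** For [m = r] and a family [F] of k-sets these are the Kneser edges inside [F]; other values of
    [m] serve to build edges one set at a time. *)
Definition packings m F : {set {set {set U}}} :=
  [set g : {set {set U}} | [&& g \subset F, #|g| == m & trivIset g]].

Lemma packingsP m F g :
  reflect [/\ g \subset F, #|g| = m & trivIset g] (g \in packings m F).
Proof. by rewrite inE; apply: (iffP and3P) => -[? /eqP ? ?]. Qed.

Lemma packings0 F : #|packings 0 F| = 1.
Proof.
rewrite (_ : packings 0 F = [set set0]) ?cards1 //; apply/setP => g.
rewrite in_set1; apply/packingsP/eqP => [[_ /cards0_eq]|->] //.
by rewrite sub0set cards0; split=> //; apply/trivIsetP => A B; rewrite inE.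
Qed.

Lemma card_packings1 F : #|packings 1 F| = #|F|.
Proof.
rewrite (_ : packings 1 F = [set [set A] | A in F]).
  by rewrite card_imset //; apply: set1_inj.
apply/setP => g; apply/packingsP/imsetP => [[sgF /eqP/cards1P[A gA] _]|[A AF ->]].
  by exists A => //; rewrite gA sub1set in sgF.
rewrite sub1set AF cards1; split=> //.
by apply/trivIsetP => B C /set1P-> /set1P->; rewrite eqxx.
Qed.

Lemma leq_packings m F G : F \subset G -> #|packings m F| <= #|packings m G|.
Proof.
move=> sFG; apply/subset_leq_card/subsetP => g /packingsP[sgF cg tg].
by apply/packingsP; split=> //; apply: subset_trans sFG.
Qed.

(** Double counting of the pairs [(g, B)] with [B] in [G1] disjoint from the cover of [g]. Sent to
    [(B |: g, B)], they become distinct packings with a marked member, and [m.+1] marks are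
    possible. The empty set is excluded because it could be disjoint from the cover of [g] and
    already belong to [g]. *)
Lemma packings_step F G0 G1 m d :
  set0 \notin F -> G0 \subset F -> G1 \subset F ->
  (forall g, g \in packings m G0 ->
     d <= #|[set B in G1 | [disjoint cover g & B]]|) ->
  #|packings m G0| * d <= m.+1 * #|packings m.+1 F|.
Proof.
move=> F0 sG0 sG1 Hd.
pose P := [set gB : {set {set U}} * {set U} |
  [&& gB.1 \in packings m G0, gB.2 \in G1 & [disjoint cover gB.1 & gB.2]]].
pose Q := [set eB : {set {set U}} * {set U} |
  (eB.1 \in packings m.+1 F) && (eB.2 \in eB.1)].
have cP : #|packings m G0| * d <= #|P|.
  rewrite -sum_nat_const -sum1_card (partition_big fst (mem (packings m G0))) /=.
    apply: leq_sum => g gG; apply: leq_trans (Hd g gG) _.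
    rewrite sum1_card -(card_imset (mem [set B in G1 | [disjoint cover g & B]])
      (f := pair g)) => [|B C [] //].
    apply/subset_leq_card/subsetP => _ /imsetP[B + ->].
    rewrite in_set => /andP[BG dB]; apply/andP; split=> //=.
    by rewrite in_set /= gG BG.
  by move=> gB; rewrite in_set => /and3P[].
have cQ : #|Q| = m.+1 * #|packings m.+1 F|.
  rewrite mulnC -sum_nat_const -sum1_card (partition_big fst (mem (packings m.+1 F))) /=.
    apply: eq_bigr => g gG; have /packingsP[_ cg _] := gG.
    rewrite sum1_card -cg -(card_imset (mem g) (f := pair g)) => [|B C [] //].
    apply: eq_card => -[e B]; apply/andP/imsetP => /=.
      by rewrite in_set /= => -[/andP[_ Be] /eqP <-]; exists B.
    by move=> [C Cg [-> ->]]; rewrite in_set /= gG eqxx.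
  by move=> gB; rewrite in_set => /andP[].
rewrite -cQ; apply: leq_trans cP _.
have Pdis g B : (g, B) \in P ->
    [/\ B |: g \in packings m.+1 F, B \notin g & (B |: g) :\ B = g].
  rewrite in_set /= => /and3P[/packingsP[sgG cg tg] BG dis].
  have dB (C : {set U}) : C \in g -> [disjoint B & C].
    move=> Cg; rewrite disjoint_sym; apply: disjointWl dis.
    by rewrite /cover (bigcup_max C).
  have g0 : set0 \notin g.
    by apply: contra F0 => ?; apply: (subsetP sG0); apply: (subsetP sgG).
  have [tBg Bg] := trivIsetU1 dB tg g0.
  split=> //; last by rewrite setU1K.
  apply/packingsP; split=> //; last by rewrite cardsU1 Bg cg.
  by rewrite subUset sub1set (subsetP sG1) // (subset_trans sgG).
rewrite -(card_in_imset (f := fun gB : {set {set U}} * {set U} => (gB.2 |: gB.1, gB.2)) (D := mem P)).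
  apply/subset_leq_card/subsetP => _ /imsetP[[g B] gBP ->].
  by rewrite in_set /= setU11 andbT; have [] := Pdis _ _ gBP.
move=> [g B] [g' B'] /= /Pdis[_ _ Eg] /Pdis[_ _ Eg'] [E1 E2].
by rewrite -Eg -Eg' E1 E2.
Qed.

Definition through F x : {set {set U}} := [set A in F | x \in A].
Definition avoiding F Z : {set {set U}} := [set A in F | [disjoint A & Z]].

Lemma through_sub F x : through F x \subset F.
Proof. by apply/subsetP => A; rewrite inE => /andP[]. Qed.

Lemma avoiding_sub F Z : avoiding F Z \subset F.
Proof. by apply/subsetP => A; rewrite inE => /andP[]. Qed.

Lemma leq_card_bigcup (I : finType) (P : {set I}) (f : I -> {set {set U}}) :
  #|\bigcup_(i in P) f i| <= \sum_(i in P) #|f i|.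
Proof.
elim/big_rec2: _ => [|i m G _ IH]; first by rewrite cards0.
by rewrite (leq_trans (leq_card_setU _ _)) // leq_add2l.
Qed.

(** Union bound: a member through [x] that meets [Z] contains some [y] of [Z], distinct from [x],
    and each [y] accounts for at most [d] of them. *)
Lemma card_through_disjoint F G Z x d :
  G \subset F -> x \notin Z ->
  (forall y, y != x -> #|[set A in F | (x \in A) && (y \in A)]| <= d) ->
  #|through G x| <= #|[set B in through G x | [disjoint Z & B]]| + #|Z| * d.
Proof.
move=> sGF xZ Hd.
rewrite -(cardsID [set B : {set U} | [disjoint Z & B]]) leq_add //.
  by apply: subset_leq_card; apply/subsetP => B; rewrite !inE.
rewrite -sum_nat_const.
apply: leq_trans (_ : _ <= \sum_(y in Z) #|[set A in F | (x \in A) && (y \in A)]|) _.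
  apply: leq_trans (leq_card_bigcup _ _).
  apply/subset_leq_card/subsetP => B; rewrite !inE => /and3P[+ BG xB].
  rewrite -setI_eq0 => /set0Pn[y /setIP[yZ yB]].
  by apply/bigcupP; exists y; rewrite // inE (subsetP sGF) // xB yB.
by apply: leq_sum => y yZ; apply: Hd; apply: contraNneq xZ => <-.
Qed.

Lemma card_cover_packing F k m g :
  (forall A, A \in F -> #|A| = k) -> g \in packings m F -> #|cover g| = m * k.
Proof.
move=> Fk /packingsP[sgF cg /eqP <-].
by rewrite -cg -sum_nat_const; apply: eq_bigr => A Ag; apply/Fk/(subsetP sgF).
Qed.

End Packings.

(** * Counting packings from degree and codegree bounds *)

Section Supersaturation.
Variable U : finType.
Implicit Types (F G g e : {set {set U}}) (A B Y Z : {set U}) (x y : U).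

Definition uniform k F := forall A, A \in F -> #|A| = k.
Definition codegree F x y := #|[set A in F | (x \in A) && (y \in A)]|.

(** Induction on [Y]: the points other than [y] are treated inside the members of [F] avoiding [y],
    where degrees drop by at most [c], and a set through [y] is added last. The packing built so far
    misses [y], so it blocks at most [c] sets through [y] for each point that it covers. Each
    addition costs a factor [r], a bound on the number of marks in [packings_step]. *)
Lemma packings_extend F Y k c d m r :
  0 < k -> uniform k F -> (forall x y, y != x -> codegree F x y <= c) ->
  m + #|Y| <= r ->
  (forall y, y \in Y -> d + (m + #|Y|) * k.+1 * c <= #|through F y|) ->
  #|packings m (avoiding F Y)| * d ^ #|Y| <= r ^ #|Y| * #|packings (m + #|Y|) F|.
Proof.
move=> k0; have [j] := ubnP #|Y|; elim: j => // j IH in F Y * => ltj Fk Fc mr Hd.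
have [->|[y yY]] := set_0Vmem Y.
  rewrite cards0 addn0 !expn0 muln1 mul1n leq_packings //; exact: avoiding_sub.
have cY : #|Y| = #|Y :\ y|.+1 by rewrite (cardsD1 y) yY.
set F1 := avoiding F [set y].
have F1F : F1 \subset F by apply: avoiding_sub.
have EF : avoiding F Y = avoiding F1 (Y :\ y).
  apply/setP => A; rewrite !inE -andbA; congr (_ && _).
  by rewrite -!setI_eq0 -{1}(setD1K yY) setIUr setU_eq0.
have IH1 : #|packings m (avoiding F1 (Y :\ y))| * d ^ #|Y :\ y| <=
           r ^ #|Y :\ y| * #|packings (m + #|Y :\ y|) F1|.
  apply: IH.
  - by move: ltj; rewrite cY.
  - by move=> A /(subsetP F1F)/Fk.
  - move=> x z xz; apply: leq_trans (Fc _ _ xz); apply/subset_leq_card/subsetP => A.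
    by rewrite !inE => /andP[/andP[-> _] ->].
  - by move: mr; rewrite cY; lia.
  move=> z /setD1P[zy zY].
  have : #|through F z| <= #|through F1 z| + c.
    rewrite -(cardsID [set B : {set U} | y \notin B]) leq_add //.
      apply/subset_leq_card/subsetP => B; rewrite !inE => /andP[/andP[-> ->] yB].
      by rewrite andbT /= disjoint_sym disjoints1.
    apply: leq_trans (Fc _ _ zy); apply/subset_leq_card/subsetP => B.
    by rewrite !inE negbK => /and3P[-> -> ->].
  have := Hd z zY; rewrite cY; nia.
have F0 : set0 \notin F by apply/negP => /Fk; rewrite cards0 => E; rewrite -E in k0.
have := @packings_step U F F1 (through F y) (m + #|Y :\ y|) d F0 F1F (through_sub _ _).
have Hg g : g \in packings (m + #|Y :\ y|) F1 ->
    d <= #|[set B in through F y | [disjoint cover g & B]]|.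
  move=> gP; have yg : y \notin cover g.
    have /packingsP[sg _ _] := gP.
    apply/negP => /bigcupP[A /(subsetP sg)]; rewrite inE => /andP[_].
    by rewrite disjoint_sym disjoints1 => /negP.
  have := card_through_disjoint (subxx F) yg (Fc y).
  rewrite (@card_cover_packing _ F1 k (m + #|Y :\ y|)) //; last first.
    by move=> A /(subsetP F1F)/Fk.
  have := Hd y yY; rewrite cY; nia.
move=> /(_ Hg); rewrite EF cY !expnS -addnS => H1.
rewrite mulnA mulnAC (leq_trans (leq_mul IH1 (leqnn d))) //.
rewrite -mulnA [r * _]mulnC -mulnA leq_mul2l (leq_trans H1) ?orbT //.
by rewrite leq_mul2r -cY mr orbT.
Qed.

Lemma sum_through (F : {set {set U}}) (h : U -> nat) :
  \sum_(A in F) \sum_(x in A) h x = \sum_x #|through F x| * h x.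
Proof.
rewrite (exchange_big_dep predT) //=; apply: eq_bigr => x _.
rewrite -sum_nat_const; apply: eq_bigl => A; by rewrite inE.
Qed.

(** Bounding the members that meet [A] by the sum of [k] degrees only gives [k * T / a], too much by
    a factor [k]. The second moment of this sum over [F], controlled by the codegrees, shows that
    for at least half of the [A] it is at most [#|F| / (4 * r)]; disjoint sets are then chosen
    greedily. *)
Lemma packings_spread F k c T a r m :
  0 < k -> uniform k F -> (forall x y, y != x -> codegree F x y <= c) ->
  0 < T -> 0 < r -> a ^ 3 * k ^ 2 * c <= T -> T <= 2 * #|F| -> 24 * r <= a ->
  (forall x, a * #|through F x| <= T) -> m <= r ->
  #|F| ^ m <= (4 * r) ^ m * #|packings m F|.
Proof.
move=> k0 Fk Fc T0 r0 Hc HT ar Ha mr.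
set f := #|F|; have f0 : 0 < f by lia.
pose dg x := #|through F x|.
pose w (A : {set U}) := \sum_(x in A) dg x.
pose Q := \sum_(A in F) w A.
have EQ : Q = \sum_x dg x * dg x by rewrite /Q sum_through.
have Edg : \sum_x dg x = f * k.
  under eq_bigr do rewrite -[dg _]muln1.
  rewrite -sum_through -sum_nat_const; apply: eq_bigr => A /Fk <-.
  by rewrite sum1_card.
(* Expanding the square gives a sum over pairs [(x, y)]. The diagonal contributes [dg x ^ 3], at
   most [T / a] times [dg x ^ 2]; the other pairs have codegree at most [c], and the degrees sum to
   [f * k]. *)
have Ew2 : a * a * (\sum_(A in F) w A ^ 2) <= a * T * Q + a * a * (c * (f * k) ^ 2).
  have -> : \sum_(A in F) w A ^ 2 =
      \sum_x dg x * \sum_y dg y * codegree F x y.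
    under eq_bigr do rewrite -mulnn {1}/w big_distrl /=.
    rewrite (exchange_big_dep predT) //=; apply: eq_bigr => x _.
    rewrite -big_distrr; congr (_ * _).
    rewrite (eq_bigl [pred A in through F x]) => [|A]; last by rewrite !inE.
    rewrite sum_through; apply: eq_bigr => y _; rewrite mulnC; congr (_ * _).
    by apply: eq_card => A; rewrite !inE andbA.
  apply: (@leq_trans (a * a * (\sum_x (dg x * dg x * dg x + dg x * (c * (f * k)))))).
    rewrite leq_mul2l; apply/orP; right; apply: leq_sum => x _.
    rewrite -mulnA -mulnDr leq_mul2l; apply/orP; right.
    rewrite (bigD1 x) //= leq_add //.
      rewrite leq_mul2l; apply/orP; right.
      by apply/subset_leq_card/subsetP => A; rewrite !inE andbb.
    rewrite -Edg big_distrr /= [leqRHS](bigD1 x) //= -[leqLHS]add0n leq_add //.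
    by apply: leq_sum => y yx; rewrite mulnC leq_mul2r Fc ?orbT.
  rewrite big_split /= -big_distrl /= Edg mulnDr leq_add //.
    rewrite EQ !big_distrr /=; apply: leq_sum => x _.
    by have := Ha x; rewrite -/(dg x); nia.
  by rewrite -mulnn; nia.
have HQ : a * Q <= 3 * f * f.
  (* AM-GM with the weight [T / a], which dominates all the degrees. *)
  have AM : 2 * T * a * Q <= a * a * (\sum_(A in F) w A ^ 2) + f * T ^ 2.
    rewrite /Q -sum_nat_const !big_distrr /= -big_split /=; apply: leq_sum => A _.
    have := (nat_Cauchy (a * w A) T).1; rewrite -!mulnn; nia.
  have a0 : 0 < a by lia.
  have H1 : a * T * Q <= a * a * (c * (f * k) ^ 2) + f * T ^ 2 by nia.
  have H2 : a * (a * a * (c * (f * k) ^ 2)) <= T * f ^ 2.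
    rewrite (_ : _ * _ = (a ^ 3 * k ^ 2 * c) * f ^ 2); last by nia.
    by rewrite leq_mul2r Hc orbT.
  have H3 : a * a * Q <= f ^ 2 + a * f * T.
    rewrite -(leq_pmul2l T0); nia.
  rewrite -(leq_pmul2l a0); nia.
(* [w A] bounds the number of members of [F] meeting [A]; by Markov's inequality
   at least half of [F] has small [w], and a packing in that half extends. *)
pose G := [set A in F | 4 * r * w A <= f].
have sGF : G \subset F by apply/subsetP => A; rewrite inE => /andP[].
have cG : f <= 2 * #|G|.
  have : #|F :\: G| * f <= 4 * r * Q.
    rewrite -sum_nat_const /Q [X in _ <= _ * X](big_setID G) /= mulnDr.
    apply: leq_trans (leq_addl _ _); rewrite big_distrr /=.
    by apply: leq_sum => A; rewrite !inE => /andP[+ AF]; rewrite AF /=; lia.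
  have : f = #|G| + #|F :\: G|.
    by rewrite /f -(cardsID G F) (setIidPr sGF).
  nia.
have F0 : set0 \notin F by apply/negP => /Fk; rewrite cards0 => E; rewrite -E in k0.
apply: (@leq_trans ((4 * r) ^ m * #|packings m G|)); last first.
  by rewrite leq_mul2l leq_packings ?orbT.
elim: m mr => [|m IH] mr; first by rewrite packings0 !expn0.
(* At least half of [F] lies in [G], and the fewer than [r] members of [g] meet at most a quarter of
   [F]; [(f + 3) %/ 4] is a quarter rounded up. *)
have Hg g : g \in packings m G ->
    (f + 3) %/ 4 <= #|[set B in G | [disjoint cover g & B]]|.
  move=> /packingsP[sgG cg tg].
  have : #|G| <= #|[set B in G | [disjoint cover g & B]]| + \sum_(A in g) w A.
    rewrite -(cardsID [set B : {set U} | [disjoint cover g & B]]) leq_add //.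
      by apply: subset_leq_card; apply/subsetP => B; rewrite !inE.
    apply: (@leq_trans (\sum_(A in g) #|\bigcup_(x in A) through F x|)); last first.
      by apply: leq_sum => A _; apply: leq_card_bigcup.
    apply: leq_trans (leq_card_bigcup _ _).
    apply/subset_leq_card/subsetP => B; rewrite !inE => /and3P[+ BF _].
    rewrite -setI_eq0 => /set0Pn[x /setIP[/bigcupP[A Ag xA] xB]].
    by apply/bigcupP; exists A => //; apply/bigcupP; exists x; rewrite // inE BF.
  have : 4 * r * \sum_(A in g) w A <= m * f.
    rewrite -cg -sum_nat_const big_distrr /=; apply: leq_sum => A /(subsetP sgG).
    by rewrite inE => /andP[].
  move=> H4 H5; have : 4 * \sum_(A in g) w A <= f by nia.
  lia.
have sG0 : set0 \notin G by apply: contra F0 => /(subsetP sGF).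
have := packings_step sG0 (subxx G) (subxx G) Hg.
have := IH (ltnW mr); rewrite !expnS.
set x1 := f ^ m; set x2 := (4 * r) ^ m; set x3 := #|_|; set x4 := #|_|.
move=> H1 H2; have H3 : f * x3 <= 4 * r * x4 by nia.
rewrite (leq_trans (leq_mul (leqnn f) H1)) // mulnCA -mulnA.
by rewrite [leqRHS]mulnCA leq_mul2l H3 orbT.
Qed.

End Supersaturation.

(** * Unions of stars and supersaturation *)

Lemma card_subsets_between (U : finType) (Z W : {set U}) k :
  [disjoint Z & W] -> #|Z| <= k ->
  #|[set A : {set U} | [&& #|A| == k, Z \subset A & [disjoint A & W]]]|
    = 'C(#|U| - #|Z| - #|W|, k - #|Z|).
Proof.
move=> dZW Zk.
have -> : #|U| - #|Z| - #|W| = #|~: (Z :|: W)|.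
  by rewrite [RHS]cardsCs setCK cardsU (disjoint_setI0 dZW) cards0; lia.
rewrite -cards_draws; set D := [set A : {set U} | A \subset _ & _].
rewrite -[#|D|](card_in_imset (f := fun B => Z :|: B) (D := mem D)); last first.
  move=> B C; rewrite !inE setCU !subsetI -!disjoints_subset => /andP[/andP[dB _] _].
  move=> /andP[/andP[dC _] _] E; apply/setP => x.
  have := congr1 (fun D : {set U} => x \in D) E; rewrite !inE.
  case: (boolP (x \in Z)) => //= xZ _.
  by rewrite (disjointFl dB xZ) (disjointFl dC xZ).
apply: eq_card => A; rewrite inE; apply/and3P/imsetP.
  move=> [/eqP cA ZA dA]; exists (A :\: Z); last by rewrite -{1}(setID A Z) (setIidPr ZA).
  rewrite inE cardsD (setIidPr ZA) cA eqxx andbT setCU subsetI -!disjoints_subset.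
  by rewrite (disjointWl _ dA) ?subsetDl // andbT -setI_eq0 setIDAC setDIl setDv setI0.
move=> [B]; rewrite inE setCU subsetI -!disjoints_subset => /andP[/andP[dB dBW] /eqP cB] ->.
rewrite subsetUl cardsU (setIC Z) (disjoint_setI0 dB) cards0 cB; split=> //.
  by apply/eqP; lia.
by rewrite -setI_eq0 setIUl setU_eq0 !setI_eq0 dZW.
Qed.

Lemma leq_expl m n e : m <= n -> m ^ e <= n ^ e.
Proof. by case: e => // e; rewrite leq_exp2r. Qed.

Lemma exists_subset_card (U : finType) (L : {set U}) s :
  s <= #|L| -> exists2 Y : {set U}, Y \subset L & #|Y| = s.
Proof.
move=> sL; have : 0 < #|[set A : {set U} | A \subset L & #|A| == s]|.
  by rewrite cards_draws bin_gt0.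
by case/card_gt0P => Y; rewrite inE => /andP[? /eqP]; exists Y.
Qed.

(** Pascal's rule applied [i] times; each of the [i] increments is at most the first one. *)
Lemma bin_shift_le m j i : 'C(m, j.+1) <= 'C(m - i, j.+1) + i * 'C(m.-1, j).
Proof.
elim: i => [|i IH]; first by rewrite subn0 mul0n addn0.
apply: leq_trans IH _; rewrite mulSn addnA leq_add2r.
have [mi|mi] := leqP m i.
  by rewrite (eqP mi) !bin0n.
have -> : m - i = (m - i.+1).+1 by lia.
by rewrite binS leq_add2l leq_bin2l //; lia.
Qed.

(** Bonferroni's inequality for [s] stars of sets of size [k.+2]: their union has size
    ['C(n, k.+2) - 'C(n - s, k.+2)], and two stars share ['C(n.-2, k)] sets. *)
Lemma bin_shift_ge n k s : s <= n ->
  s * 'C(n.-1, k.+1) + 'C(n - s, k.+2) <= 'C(n, k.+2) + s * s * 'C(n.-2, k).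
Proof.
elim: s => [|s IH] sn; first by rewrite subn0 !mul0n addn0.
have := IH (ltnW sn).
have := bin_shift_le n.-1 k s.
have -> : n - s = (n - s.+1).+1 by lia.
have -> : n.-1 - s = n - s.+1 by lia.
rewrite binS; nia.
Qed.

Section StarUnions.
Variables n k : nat.

Definition star_union (X : {set 'I_n}) := \bigcup_(x in X) star k x.

Lemma in_star_union X A :
  (A \in star_union X) = (A \in ksubsets n k) && ~~ [disjoint A & X].
Proof.
apply/bigcupP/andP => [[x xX]|[Ak]].
  rewrite inE => /andP[-> xA]; split=> //.
  by apply/negP => /disjointFr/(_ xA); rewrite xX.
rewrite -setI_eq0 => /set0Pn[x /setIP[xA xX]]; exists x => //.
by rewrite inE Ak.
Qed.

Lemma card_ksubsets : #|ksubsets n k| = 'C(n, k).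
Proof.
by rewrite -[n in RHS]card_ord -cardsT -cards_draws; apply: eq_card => A; rewrite !inE subsetT.
Qed.

Lemma card_star (x : 'I_n) : 0 < k -> #|star k x| = 'C(n.-1, k.-1).
Proof.
move=> k0; have := @card_subsets_between 'I_n [set x] set0 k.
rewrite disjoint_sym disjoints_subset sub0set cards1 cards0 card_ord subn0 => /(_ isT).
rewrite k0 !subn1 => /(_ isT) <-; apply: eq_card => A.
by rewrite !inE sub1set disjoint_sym disjoints_subset sub0set andbT.
Qed.

Lemma card_star_union X : #|star_union X| + 'C(n - #|X|, k) = 'C(n, k).
Proof.
have := @card_subsets_between 'I_n set0 X k.
rewrite disjoints_subset sub0set cards0 card_ord !subn0 => /(_ isT isT) <-.
rewrite -card_ksubsets -(cardsID [set A : {set 'I_n} | ~~ [disjoint A & X]] (ksubsets n k)).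
congr (_ + _); apply: eq_card => A; rewrite ?inE ?in_star_union ?inE //.
by rewrite sub0set negbK andTb andbC.
Qed.

Lemma star_sizeE r (X : {set 'I_n}) :
  0 < r <= n -> #|X| = r.-1 -> #|star_union X| = star_size r n k.
Proof.
move=> rn cX; have := card_star_union X; rewrite /star_size cX.
have -> : n - r + 1 = n - r.-1 by lia.
by move=> <-; rewrite addnK.
Qed.

Lemma codegree_ksubsets (x y : 'I_n) :
  1 < k -> y != x -> codegree (ksubsets n k) x y = 'C(n.-2, k.-2).
Proof.
move=> k2 yx; have := @card_subsets_between 'I_n [set x; y] set0 k.
rewrite disjoint_sym disjoints_subset sub0set cards2 (eq_sym x) yx cards0 card_ord subn0.
move=> /(_ isT k2); rewrite !subn2 => <-; apply: eq_card => A.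
by rewrite !inE subUset !sub1set [[disjoint A & _]]disjoint_sym disjoints_subset sub0set andbT.
Qed.

End StarUnions.

(** * Supersaturation for families of the size of a union of stars *)

Section Kneser.
Variables (r n k : nat).
Hypotheses (r2 : 2 <= r) (k2 : 2 <= k) (nk : (24 * r) ^ 3 * k ^ 3 <= n).

Let T := 'C(n.-1, k.-1).
Let c := 'C(n.-2, k.-2).
Let a := 24 * r.

(** The quotient [c / T] is [(k - 1) / (n - 1)], which [nk] makes small enough. *)
Lemma codegree_small : a ^ 3 * k ^ 2 * c <= T.
Proof.
have n2 : 1 < n by nia.
have E : n.-1 * c = k.-1 * T.
  have := mul_bin_diag n.-1 k.-2; rewrite /c /T.
  by have -> : k.-2.+1 = k.-1 by lia.
rewrite -(@leq_pmul2l n.-1); last by lia.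
rewrite mulnCA E [leqLHS]mulnA leq_mul2r; apply/orP; right.
have := nk; rewrite -/a; set b := a ^ 3 => nk'; have b0 : 0 < b by rewrite expn_gt0 /a; lia.
have : b * k ^ 2 * k.-1 + b * k ^ 2 <= n.
  by apply: leq_trans nk'; rewrite expnS; nia.
have : 0 < b * k ^ 2 by rewrite muln_gt0 b0 expn_gt0; lia.
lia.
Qed.

(** The overlaps of the [r - 1] stars cost at most [T / 2] in all. Hence at least [T / 2] sets
    remain in a family of this size once at most [r - 2] stars are removed. *)
Lemma star_size_ge : (2 * r.-1 - 1) * T <= 2 * star_size r n k.
Proof.
have cs := codegree_small.
have rn : r.-1 <= n by nia.
have := @bin_shift_ge n k.-2 r.-1 rn.
have -> : k.-2.+1 = k.-1 by lia.
have -> : k.-1.+1 = k by lia.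
rewrite -/T -/c /star_size.
have -> : n - r + 1 = n - r.-1 by nia.
have : 2 * (r.-1 * r.-1 * c) <= T.
  apply: leq_trans cs; rewrite mulnA leq_mul2r; apply/orP; right.
  rewrite /a; nia.
lia.
Qed.

Lemma star_size_le : star_size r n k <= r.-1 * T.
Proof.
have rn : r.-1 <= #|[set: 'I_n]| by rewrite cardsT card_ord; nia.
have [Y _ cY] := exists_subset_card rn.
have rn' : 0 < r <= n by nia.
rewrite -(star_sizeE k rn' cY) -cY -sum_nat_const.
by apply: leq_trans (leq_card_bigcup _ _) _; apply: leq_sum => x _; rewrite card_star //; lia.
Qed.

(** The power of [48 * r ^ 2] collects the losses of [packings_extend] and [packings_spread], with
    [48 * r = 2 * a] coming from halved degrees; the factor [r] bounds [#|F| / T] when edges are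
    counted by [T ^ r]. *)
Definition Gamma := r * (48 * r ^ 2) ^ r.

Lemma supersaturation (F : {set {set 'I_n}}) :
  F \subset ksubsets n k -> #|F| = star_size r n k ->
  exists2 X : {set 'I_n}, #|X| = r.-1 &
    #|F :\: star_union k X| * T ^ r.-1 <= Gamma * #|packings r F|.
Proof.
move=> sF cF.
have Fk : uniform k F by move=> A /(subsetP sF); rewrite inE => /eqP.
have Fc x y : y != x -> codegree F x y <= c.
  move=> yx; rewrite /c -(codegree_ksubsets k2 yx); apply/subset_leq_card/subsetP => A.
  by rewrite !inE => /andP[/(subsetP sF)]; rewrite inE => ->.
have k0 : 0 < k by lia.
have c0 : 0 < c by rewrite bin_gt0; nia.
have cs := codegree_small.
have a48 : 48 <= a by rewrite /a; lia.
have T0 : 0 < T by rewrite bin_gt0; nia.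
pose L := [set x | T <= a * #|through F x|].
(* Half of the least degree [T / a] of a point of [L], rounded up; the other half absorbs the
   codegree losses in [packings_extend]. *)
pose d := (T + 2 * a - 1) %/ (2 * a).
have Td : T <= 2 * a * d by rewrite /d; lia.
have Hd x m : x \in L -> m <= r -> d + m * k.+1 * c <= #|through F x|.
  rewrite inE => Hx mr.
  rewrite -(@leq_pmul2l (2 * a)); last by lia.
  have H1 : 2 * a * d <= T + 2 * a by rewrite /d; lia.
  have H2 : 2 * a + 2 * a * (m * k.+1 * c) <= T.
    apply: leq_trans cs.
    apply: (@leq_trans ((2 * a + 2 * a * (r * k.+1)) * c)).
      rewrite mulnDl leq_add ?leq_pmulr // -!mulnA.
      by rewrite !leq_mul2l leq_mul2r mr !orbT.
    rewrite leq_mul2r; apply/orP; right.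
    have : 2 + 2 * (r * k.+1) <= a ^ 2 * k ^ 2.
      have -> : a ^ 2 * k ^ 2 = 576 * ((r * k) * (r * k)).
        by rewrite mulnn -!expnMn -[576]/(24 ^ 2) -expnMn mulnA.
      have : r <= r * k by rewrite leq_pmulr.
      by rewrite mulnS; nia.
    by rewrite -mulnA -mulnDr -mulnA -[2]/(1 + 1) => H; rewrite (expnS a 2) -mulnA; nia.
  rewrite mulnDr; lia.
have avE Y : avoiding F Y = F :\: star_union k Y.
  apply/setP => A; rewrite in_setD in_star_union !inE.
  have [AF|] := boolP (A \in F); last by rewrite andbF.
  by have := subsetP sF _ AF; rewrite inE => ->; rewrite negbK andbT.
have G0 (m j : nat) : m + j <= r -> (2 * a) ^ j * r ^ j * (8 * r) ^ m <= (48 * r ^ 2) ^ r.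
  move=> mj; have -> : (2 * a) ^ j * r ^ j = (48 * r ^ 2) ^ j.
    by rewrite -expnMn /a; congr (_ ^ _); lia.
  apply: (@leq_trans ((48 * r ^ 2) ^ j * (48 * r ^ 2) ^ m)).
    by rewrite leq_mul2l leq_expl ?orbT //; nia.
  by rewrite -expnD leq_pexp2l //; lia.
(* With [r - 1] points of high degree, each set of [F] avoiding them is a packing of size 1, to be
   completed by one set through each center. *)
have [sL|Ls] := leqP r.-1 #|L|.
  have [Y YL cY] := exists_subset_card sL.
  exists Y => //.
  have := @packings_extend _ F Y k c d 1 r k0 Fk Fc.
  rewrite cY add1n prednK; last by lia.
  move=> /(_ (leqnn r)) H; rewrite avE card_packings1 in H.
  have {}H := H (fun y yY => Hd y r (subsetP YL y yY) (leqnn r)).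
  have HT : T ^ r.-1 <= (2 * a) ^ r.-1 * d ^ r.-1 by rewrite -expnMn leq_expl.
  have := G0 0 r.-1; rewrite expn0 muln1 add0n => /(_ (leq_pred r)).
  rewrite /Gamma.
  set x1 := #|_| in H *; set x2 := #|_| in H *.
  move: H HT; set y1 := d ^ _; set y2 := r ^ _; set y3 := T ^ _; set y4 := (2 * a) ^ _.
  set y5 := _ ^ r => H HT HG.
  apply: (@leq_trans (y4 * (x1 * y1))); first by rewrite mulnCA leq_mul2l HT orbT.
  apply: leq_trans (_ : y4 * (y2 * x2) <= _); first by rewrite leq_mul2l H orbT.
  rewrite mulnA leq_mul2r (leq_trans HG) ?orbT //.
  by rewrite leq_pmull //; lia.
(* Otherwise at least two members of an edge, [m] in number, are taken among the sets avoiding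
   [L]. *)
set F' := avoiding F L; set f := #|F'|.
pose m := r - #|L|.
have mL : m + #|L| = r by rewrite /m; lia.
have F'F : F' \subset F by apply: avoiding_sub.
have Hf : T <= 2 * f.
  have H1 : #|F| <= f + #|L| * T.
    rewrite -(cardsID (star_union k L) F) addnC /f /F' avE leq_add2l.
    rewrite -sum_nat_const.
    apply: leq_trans (_ : #|star_union k L| <= _).
      by apply: subset_leq_card; rewrite subsetIr.
    by apply: leq_trans (leq_card_bigcup _ _) _; apply: leq_sum => x _; rewrite card_star //; lia.
  have := star_size_ge; rewrite -cF.
  have : #|L| * T <= (r.-1 - 1) * T by rewrite leq_mul2r; lia.
  nia.
have Hsp : f ^ m <= (4 * r) ^ m * #|packings m F'|.
  apply: (@packings_spread _ F' k c T a) => //.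
  - by move=> A /(subsetP F'F)/Fk.
  - move=> x y xy; apply: leq_trans (Fc x y xy); apply/subset_leq_card/subsetP => A.
    by rewrite !inE => /andP[/andP[-> _] ->].
  - lia.
  - move=> x; have [xL|xL] := boolP (x \in L).
      rewrite (_ : through F' x = set0) ?cards0 ?muln0 //.
      apply/setP => A; rewrite !inE; apply/negP => /andP[/andP[_ dA] xA].
      by rewrite (disjointFr dA xA) in xL.
    move: xL; rewrite inE -ltnNge => /ltnW; apply: leq_trans.
    rewrite leq_mul2l; apply/orP; right; apply/subset_leq_card/subsetP => A.
    by rewrite !inE => /andP[/andP[-> _] ->].
  - lia.
have := @packings_extend _ F L k c d m r k0 Fk Fc.
rewrite mL => /(_ (leqnn r)) H.
have {}H := H (fun y yY => Hd y r yY (leqnn r)); rewrite -/F' in H.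
(* The number of edges is now of order [T ^ r], so any center will do, thanks to [#|F| <= r * T]. *)
have rn : r.-1 <= #|[set: 'I_n]| by rewrite cardsT card_ord; nia.
have [Y _ cY] := exists_subset_card rn.
exists Y => //.
apply: (@leq_trans (r * T ^ r)).
  rewrite -[in T ^ r](@prednK r) ?expnS; last by lia.
  rewrite mulnA leq_mul2r; apply/orP; right.
  apply: (@leq_trans #|F|); first by apply: subset_leq_card; apply: subsetDl.
  by rewrite cF (leq_trans star_size_le) // leq_mul2r leq_pred orbT.
rewrite /Gamma -mulnA leq_mul2l; apply/orP; right.
rewrite -{1}mL expnD.
have HT : T ^ #|L| <= (2 * a) ^ #|L| * d ^ #|L| by rewrite -expnMn leq_expl.
have Hm : T ^ m <= 2 ^ m * f ^ m by rewrite -expnMn leq_expl.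
have E8 : (8 * r) ^ m = 2 ^ m * (4 * r) ^ m by rewrite -expnMn; congr (_ ^ _); lia.
have := G0 m #|L|; rewrite mL => /(_ (leqnn r)); rewrite E8.
move: H HT Hm Hsp; set x1 := #|packings m F'|; set x2 := #|packings r F|.
set y1 := d ^ _; set y2 := r ^ _; set y3 := T ^ _; set y4 := (2 * a) ^ _.
set y5 := T ^ _; set y6 := f ^ _; set y7 := 2 ^ _; set y8 := (4 * r) ^ _; set y9 := _ ^ r.
move=> H HT Hm Hsp HG.
apply: leq_trans (leq_mul Hm HT) _.
apply: (@leq_trans (y7 * y4 * y8 * (x1 * y1))).
  have -> : y7 * y6 * (y4 * y1) = (y7 * y4 * y1) * y6 by lia.
  have -> : y7 * y4 * y8 * (x1 * y1) = (y7 * y4 * y1) * (y8 * x1) by lia.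
  by rewrite leq_mul2l Hsp orbT.
apply: (@leq_trans (y7 * y4 * y8 * (y2 * x2))); first by rewrite leq_mul2l H orbT.
have -> : y7 * y4 * y8 * (y2 * x2) = (y4 * y2 * (y7 * y8)) * x2 by lia.
by rewrite leq_mul2r HG orbT.
Qed.

End Kneser.

(** The traces on [X] are nonempty and pairwise disjoint. *)
Lemma card_trivIset_meet (U : finType) (X : {set U}) (e : {set {set U}}) :
  trivIset e -> (forall B, B \in e -> ~~ [disjoint B & X]) -> #|e| <= #|X|.
Proof.
move=> te eX.
have tX : trivIset [set B :&: X | B in e].
  apply/trivIsetP => _ _ /imsetP[B Be ->] /imsetP[C Ce ->] BC.
  have {}BC : B != C by apply: contraNneq BC => ->.
  have /disjoint_setI0 BC0 := trivIsetP te _ _ Be Ce BC.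
  by rewrite -setI_eq0 setIACA BC0 set0I.
have inj : {in e &, injective (fun B => B :&: X)}.
  move=> B C Be Ce E; apply/eqP; apply: contraNT (eX B Be) => BC.
  have /disjoint_setI0 BC0 := trivIsetP te _ _ Be Ce BC.
  by rewrite -setI_eq0 -[B :&: X]setIid {2}E setIACA BC0 set0I.
rewrite -(card_in_imset inj).
apply: (@leq_trans #|cover [set B :&: X | B in e]|).
  rewrite -(eqP tX) -sum1_card; apply: leq_sum => _ /imsetP[B Be ->].
  by rewrite card_gt0 setI_eq0 eX.
apply/subset_leq_card/bigcupsP => _ /imsetP[B _ ->]; exact: subsetIr.
Qed.

(** * Independent sets and unions of stars *)

Section StarStructure.
Variables (r n k : nat).
Hypotheses (r2 : 2 <= r) (k2 : 2 <= k) (rkn : r + k <= n).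
Local Notation V := (ksubsets n k).

(** Turns independence into disjointness of [H] from a fixed set of edges, an event whose
    probability is a power of [1 - p]. *)
Lemma independentP (H : {set {set {set 'I_n}}}) (F : {set {set 'I_n}}) : H \subset kneser_edges r n k ->
  reflect (F \subset V /\ [disjoint packings r F & H]) (independent V H F).
Proof.
move=> HE; apply: (iffP andP) => -[FV HF]; split=> //.
  rewrite disjoint_sym disjoint_subset; apply/subsetP => e eH; rewrite inE.
  by apply/packingsP => -[eF _ _]; have := forall_inP HF e eH; rewrite eF.
apply/forall_inP => e eH; apply/negP => eF.
have : e \in packings r F.
  have := subsetP HE e eH; rewrite inE => /and3P[_ /eqP ce te]; exact/packingsP.
by move/(disjointFr HF); rewrite eH.
Qed.

Lemma independentS (H : {set {set {set 'I_n}}}) (F G : {set {set 'I_n}}) :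
  F \subset G -> independent V H G -> independent V H F.
Proof.
move=> FG /andP[GV /forall_inP HG]; rewrite /independent (subset_trans FG GV).
by apply/forall_inP => e /HG; apply: contra => eF; apply: subset_trans FG.
Qed.

Lemma independent_star_union (H : {set {set {set 'I_n}}}) (X : {set 'I_n}) :
  H \subset kneser_edges r n k -> #|X| = r.-1 -> independent V H (star_union k X).
Proof.
move=> HE cX; apply/independentP => //; split.
  by apply/subsetP => A; rewrite in_star_union => /andP[].
rewrite disjoint_subset; apply/subsetP => e /packingsP[eX ce te].
have : #|e| <= #|X|.
  apply: card_trivIset_meet => // B /(subsetP eX); rewrite in_star_union.
  by case/andP.
rewrite cX ce; lia.
Qed.

Lemma exists_center : exists X : {set 'I_n}, #|X| = r.-1.
Proof.
have rn : r.-1 <= #|[set: 'I_n]| by rewrite cardsT card_ord; lia.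
by have [X _ cX] := exists_subset_card rn; exists X.
Qed.

(** Exchange argument. If an independent set [G] were larger, all its subsets of the right size
    would be unions of stars. Let [F] be one, centered in [X]; replacing one of its sets by some [A]
    of [G] outside [F] gives another, with a center [x] in [A] outside [X]. It would contain every
    k-set through [x] avoiding [X]; there are at least two of these, and only [A] is available. *)
Lemma only_star_unions_alpha (H : {set {set {set 'I_n}}}) :
  H \subset kneser_edges r n k -> only_star_unions r n k H -> alpha_is_star_size r n k H.
Proof.
have knr : k.-1 < n.-1 - r.-1 by lia.
have kn : k.-1 <= n.-1 by lia.
move=> HE /forallP Hu; rewrite /alpha_is_star_size eqn_leq; apply/andP; split; last first.
  have [X cX] := exists_center.
  have rn : 0 < r <= n by lia.
  rewrite -(star_sizeE k rn cX).
  rewrite /alpha.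
  exact: (leq_bigmax_cond (F := fun S : {set {set 'I_n}} => #|S|) _ (independent_star_union HE cX)).
apply/bigmax_leqP => G iG; rewrite leqNgt; apply/negP => SG.
have Hs (F : {set {set 'I_n}}) : F \subset G -> #|F| = star_size r n k ->
    exists2 X : {set 'I_n}, #|X| = r.-1 & F = star_union k X.
  move=> FG cF; have /eqP := Hu F.
  rewrite (independentS FG iG) cF eqxx => /esym/existsP[X /andP[/eqP cX /eqP ->]].
  by exists X; rewrite // cX subn1.
have [F FG cF] := exists_subset_card (ltnW SG).
have [X cX EF] := Hs F FG cF.
have /card_gt0P[A] : 0 < #|G :\: F| by rewrite cardsD (setIidPr FG) cF subn_gt0.
move=> /setDP[AG AF].
have AV : A \in V by have /andP[/subsetP GV _] := iG; apply: GV.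
have AX : [disjoint A & X] by move: AF; rewrite EF in_star_union AV negbK.
have bin2 m : k.-1 < m -> 1 < 'C(m, k.-1).
  move=> km; apply: leq_trans (leq_bin2l _ km).
  by rewrite binSn; lia.
have /card_gt0P[B BF] : 0 < #|F|.
  have /card_gt0P[x xX] : 0 < #|X| by rewrite cX; lia.
  rewrite EF; apply: leq_trans (subset_leq_card (bigcup_sup x xX)).
  by rewrite card_star ?bin_gt0 // ltnW.
have BA : A != B by apply: contraNneq AF => ->.
have cF2 : #|A |: (F :\ B)| = star_size r n k.
  rewrite cardsU1 !inE (negbTE AF) andbF -cF [RHS](cardsD1 B) BF //.
have F2G : A |: (F :\ B) \subset G.
  by rewrite subUset sub1set AG (subset_trans (subsetDl _ _) FG).
have [X' cX' EF2] := Hs _ F2G cF2.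
have : A \in star_union k X' by rewrite -EF2 setU11.
rewrite in_star_union AV /= -setI_eq0 => /set0Pn[x /setIP[xA xX']].
have xX : x \notin X by rewrite (disjointFr AX xA).
have := @card_subsets_between 'I_n [set x] X k.
rewrite disjoints1 xX cards1 card_ord cX !subn1 => /(_ isT (ltnW k2)) Ec.
have : #|[set C : {set 'I_n} | [&& #|C| == k, [set x] \subset C & [disjoint C & X]]]| <= 1.
  rewrite -(cards1 A); apply/subset_leq_card/subsetP => C; rewrite inE sub1set.
  move=> /and3P[Ck xC CX]; have CV : C \in V by rewrite inE.
  have : C \in star_union k X'.
    rewrite in_star_union CV /=; apply/negP => /disjointFr/(_ xC); by rewrite xX'.
  rewrite -EF2 => /setU1P[->|/setD1P[_]]; first by rewrite inE.
  by rewrite EF in_star_union CX andbF.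
by rewrite Ec leqNgt bin2.
Qed.

End StarStructure.

(** * Edges meeting every star *)

Section Transversals.
Variables (n k : nat).
Hypothesis k0 : 0 < k.
Implicit Types (X Z B C : {set 'I_n}) (x y z : 'I_n) (g h : {set {set 'I_n}}).

(** There are as many members as points of [X], so each contains exactly one of them. For a k-set
    [Z] disjoint from [X] and [#|X| = r - 1], adding [Z] to [g] gives an edge. *)
Definition transversals X Z : {set {set {set 'I_n}}} :=
  [set g in packings #|X| (ksubsets n k) |
     [forall B in g, [disjoint B & Z] && ~~ [disjoint B & X]]].

Lemma transversalsP X Z g :
  reflect [/\ g \subset ksubsets n k, #|g| = #|X|, trivIset g,
              forall B, B \in g -> [disjoint B & Z] &
              forall B, B \in g -> exists2 x, x \in X & x \in B]
          (g \in transversals X Z).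
Proof.
rewrite !in_set -!andbA; apply: (iffP and4P) => [[sg /eqP cg tg /forall_inP H]|[sg /eqP cg tg H1 H2]].
  split=> // B /H /andP[] // _; rewrite -setI_eq0 => /set0Pn[x /setIP[xB xX]].
  by exists x.
split=> //; apply/forall_inP => B Bg; rewrite H1 //=.
by have [x xX xB] := H2 B Bg; apply/negP => /disjointFr/(_ xB); rewrite xX.
Qed.

Lemma disjoint_mem_eq g B C x :
  trivIset g -> B \in g -> C \in g -> x \in B -> x \in C -> B = C.
Proof.
move=> tg Bg Cg xB xC; apply/eqP; apply: contraT => BC.
by have /disjointFr/(_ xB) := trivIsetP tg _ _ Bg Cg BC; rewrite xC.
Qed.

(** Choosing a point of [X] in each member is injective by disjointness, hence onto [X] by
    cardinality. *)
Lemma transversals_meet X Z g : g \in transversals X Z ->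
  exists2 f : {set 'I_n} -> option 'I_n, forall x, x \in X -> exists2 B, B \in g & f B = Some x &
    forall B x, f B = Some x -> x \in B.
Proof.
move=> /transversalsP[sg cg tg gZ gX].
pose f (B : {set 'I_n}) := [pick x | (x \in B) && (x \in X)].
have fP B x : f B = Some x -> x \in B.
  by rewrite /f; case: pickP => // z /andP[zB _] [<-].
exists f => // x xX.
have f_inj : {in g &, injective f}.
  move=> B C Bg Cg; rewrite {1}/f; case: pickP => [z /andP[zB zX] E|E].
    apply: disjoint_mem_eq tg Bg Cg zB _; exact/fP.
  by have [z zX zB] := gX B Bg; have := E z; rewrite zB zX.
have sfX : f @: g \subset [set Some z | z in X].
  apply/subsetP => _ /imsetP[B Bg ->]; rewrite /f; case: pickP => [z /andP[_ zX]|E].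
    exact: imset_f.
  by have [z zX zB] := gX B Bg; have := E z; rewrite zB zX.
have : Some x \in f @: g.
  suff -> : f @: g = [set Some z | z in X] by apply: imset_f.
  apply/eqP; rewrite eqEcard sfX (card_in_imset f_inj) cg.
  by rewrite card_imset ?leqnn // => u v [].
by case/imsetP => B Bg E; exists B.
Qed.

Lemma transversals_cover X Z g : g \in transversals X Z -> X \subset cover g.
Proof.
move=> gT; have [f Hf fP] := transversals_meet gT.
by apply/subsetP => x /Hf[B Bg /fP xB]; apply/bigcupP; exists B.
Qed.

Lemma transversals_uniq X Z g B x y : g \in transversals X Z -> B \in g ->
  x \in X -> x \in B -> y \in X -> y \in B -> x = y.
Proof.
move=> gT Bg xX xB yX yB; have [f Hf fP] := transversals_meet gT.
have /transversalsP[_ _ tg _ _] := gT.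
have [C Cg fC] := Hf x xX; have [D Dg fD] := Hf y yX.
have EC := disjoint_mem_eq tg Bg Cg xB (fP _ _ fC).
have ED := disjoint_mem_eq tg Bg Dg yB (fP _ _ fD).
by move: fC fD; rewrite -EC -ED => -> [].
Qed.

Lemma ksubset_nonempty B : B \in ksubsets n k -> B != set0.
Proof.
rewrite inE => /eqP cB; apply/eqP => B0; move: k0; by rewrite -cB B0 cards0.
Qed.

(** Transversals are sorted by their block [B] through [x]: it avoids the rest of [X], and the other
    members form a transversal of [X :\ x] that avoids [B] as well as [Z]. *)
Lemma card_transversals_rec X Z x : x \in X ->
  #|transversals X Z| =
  \sum_(B in [set A : {set 'I_n} | [&& #|A| == k, [set x] \subset A &
              [disjoint A & Z :|: (X :\ x)]]])
     #|transversals (X :\ x) (Z :|: B)|.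
Proof.
move=> xX; set P := [set A : {set 'I_n} | _].
have cX : #|X| = #|X :\ x|.+1 by rewrite (cardsD1 x) xX.
have PE B : B \in P -> [/\ B \in ksubsets n k, x \in B, [disjoint B & Z] & [disjoint B & X :\ x]].
  rewrite !inE sub1set => /and3P[cB xB]; rewrite -setI_eq0 setIUr setU_eq0 !setI_eq0.
  by case/andP.
have inP g : g \in transversals X Z -> pblock g x \in P /\ pblock g x \in g.
  move=> gT; have /transversalsP[sg cg tg gZ gX] := gT.
  have xg : x \in cover g by apply: (subsetP (transversals_cover gT)).
  have Bg := pblock_mem xg; split=> //; rewrite inE.
  have := subsetP sg _ Bg; rewrite inE => -> /=.
  rewrite sub1set mem_pblock xg /= -setI_eq0 setIUr setU_eq0 !setI_eq0 gZ //=.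
  rewrite -setI_eq0; apply/eqP/setP => y; rewrite !inE; apply/negP => /and3P[yB yx yX].
  have xB : x \in pblock g x by rewrite mem_pblock.
  by rewrite (transversals_uniq gT Bg yX yB xX xB) eqxx in yx.
rewrite -sum1_card (partition_big (fun g => pblock g x) (mem P)) => [|g /inP[]//].
apply: eq_bigr => B BP; rewrite sum1_card.
have [Bk xB BZ BX] := PE B BP.
have hB h : h \in transversals (X :\ x) (Z :|: B) -> B \notin h.
  move=> /transversalsP[_ _ _ hZ _]; apply/negP => /hZ.
  rewrite -setI_eq0 setIUr setU_eq0 setIid => /andP[_].
  by rewrite (negbTE (ksubset_nonempty Bk)).
rewrite -(card_in_imset (f := fun h : {set {set 'I_n}} => B |: h)
   (D := mem (transversals (X :\ x) (Z :|: B)))); last first.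
  by move=> h h' /hB Bh /hB Bh' E; rewrite -(setU1K Bh) E setU1K.
apply: eq_card => g; apply/andP/imsetP => /=.
  move=> [gT /eqP EB]; have [_] := inP g gT; rewrite EB => Bg.
  have /transversalsP[sg cg tg gZ gX] := gT.
  exists (g :\ B); last by rewrite setD1K.
  apply/transversalsP; split.
  - by apply: subset_trans sg; apply: subsetDl.
  - by apply/eqP; rewrite -(eqn_add2l 1) -{1}[1]/(true : nat) -{1}Bg -cardsD1 cg cX.
  - by apply: trivIsetS tg; apply: subsetDl.
  - move=> C /setD1P[CB Cg]; rewrite -setI_eq0 setIUr setU_eq0 !setI_eq0 gZ //=.
    exact: (trivIsetP tg).
  - move=> C /setD1P[CB Cg]; have [z zX zC] := gX C Cg; exists z => //.
    apply/setD1P; split=> //; apply: contraNneq CB => Ez; rewrite Ez in zC.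
    by apply/eqP; apply: disjoint_mem_eq tg Cg Bg zC xB.
move=> [h hT ->]; have /transversalsP[sh ch th hZ hX] := hT.
have h0 : set0 \notin h.
  by apply/negP => /(subsetP sh)/ksubset_nonempty; rewrite eqxx.
have dB C : C \in h -> [disjoint B & C].
  move=> /hZ; rewrite -setI_eq0 setIUr setU_eq0 !setI_eq0 => /andP[_].
  by rewrite disjoint_sym.
have [tBh Bh] := trivIsetU1 dB th h0.
rewrite (def_pblock tBh _ xB) ?setU11 ?eqxx //; split=> //.
apply/transversalsP; split=> //.
- by rewrite subUset sub1set Bk.
- by rewrite cardsU1 Bh ch cX.
- move=> C /setU1P[->//|/hZ]; rewrite -setI_eq0 setIUr setU_eq0 !setI_eq0.
  by case/andP.
- move=> C /setU1P[->|/hX[z /setD1P[_ zX] zC]]; first by exists x.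
  by exists z.
Qed.

(** Each block chosen in [card_transversals_rec] moves one point out of [X] and adds [k] points to
    [Z]. For [#|Z| = k] and [#|X| = r - 1] the product is the denominator of [critical_p]. *)
Lemma card_transversals X Z : [disjoint X & Z] ->
  #|transversals X Z| =
    \prod_(0 <= i < #|X|) 'C(n - #|Z| - i * k - (#|X| - i), k - 1).
Proof.
have [j] := ubnP #|X|; elim: j => // j IH in X Z * => ltj dXZ.
have [X0|[x xX]] := set_0Vmem X.
  rewrite X0 cards0 big_geq // -(packings0 (ksubsets n k)).
  apply: eq_card => g; apply/transversalsP/idP => [[sg]|gP].
    by rewrite cards0 => cg tg _ _; apply/packingsP.
  have /packingsP[sg cg tg] := gP; have g0 := cards0_eq cg.
  by rewrite g0 cards0; split; rewrite ?sub0set -?g0 //; move=> B; rewrite g0 inE.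
have cX : #|X| = #|X :\ x|.+1 by rewrite (cardsD1 x) xX.
rewrite (card_transversals_rec Z xX).
have xZ : x \notin Z by rewrite (disjointFr dXZ xX).
have dXxZ : [disjoint X :\ x & Z] by apply: disjointWl dXZ; apply: subsetDl.
rewrite (eq_bigr (fun=> \prod_(0 <= i < #|X :\ x|)
    'C(n - (#|Z| + k) - i * k - (#|X :\ x| - i), k - 1))) => [|B]; last first.
  rewrite !inE sub1set => /and3P[/eqP cB xB].
  rewrite -setI_eq0 setIUr setU_eq0 !setI_eq0 => /andP[dBZ dBX].
  rewrite IH -?cX //; last first.
    by rewrite -setI_eq0 setIUr setU_eq0 !setI_eq0 dXxZ disjoint_sym.
  by rewrite cardsU (setIC Z) (disjoint_setI0 dBZ) cards0 subn0 cB.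
rewrite sum_nat_const card_subsets_between; first last.
- by rewrite cards1.
- rewrite disjoints1 !inE negb_or xZ eqxx //.
rewrite cards1 card_ord cX big_nat_recl // mul0n subn0; congr (_ * _).
  rewrite subn0 cardsU setIC (disjoint_setI0 dXxZ) cards0 subn0; congr (binomial _ _).
  by rewrite -!subnDA add1n addnS.
by apply: eq_bigr => i _; congr 'C(_, _); rewrite mulSn; lia.
Qed.

(** The transposition of [y] and [z] fixes [X] and [Z] pointwise and carries a transversal covering
    [y] to one covering [z]. *)
Lemma transversals_through_le X Z y z :
  y \notin X :|: Z -> z \notin X :|: Z ->
  #|[set g in transversals X Z | y \in cover g]| <=
  #|[set g in transversals X Z | z \in cover g]|.
Proof.
rewrite !inE !negb_or => /andP[yX yZ] /andP[zX zZ].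
pose s := tperm y z.
have sE (B : {set 'I_n}) x : (x \in s @: B) = (s x \in B).
  by rewrite -{1}[x](tpermK y z) mem_imset //; apply: perm_inj.
have s_fix x : (x != y) -> (x != z) -> s x = x by move=> *; rewrite tpermD // eq_sym.
have sI (B C : {set 'I_n}) : y \notin C -> z \notin C -> [disjoint s @: B & C] = [disjoint B & C].
  move=> yC zC; rewrite -!setI_eq0; congr (_ == _); apply/setP => x; rewrite !inE sE.
  have [xC|] := boolP (x \in C); rewrite ?andbF ?andbT // s_fix //.
    by apply: contraNneq yC => <-.
  by apply: contraNneq zC => <-.
pose F g := [set s @: (B : {set _}) | B in g].
have Finj : injective F by apply: imset_inj; apply: imset_inj; apply: perm_inj.
rewrite -(card_imset _ Finj); apply/subset_leq_card/subsetP => _ /imsetP[g + ->].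
rewrite in_set => /andP[gT /bigcupP[A Ag yA]]; rewrite in_set.
have /transversalsP[sg cg tg gZ gX] := gT.
apply/andP; split; last first.
  by apply/bigcupP; exists (s @: A); rewrite ?sE ?tpermR //; apply: imset_f.
apply/transversalsP; split.
- apply/subsetP => _ /imsetP[B Bg ->]; rewrite inE card_imset; last exact: perm_inj.
  by have := subsetP sg _ Bg; rewrite inE.
- by rewrite card_imset //; apply: imset_inj; apply: perm_inj.
- apply/trivIsetP => _ _ /imsetP[B Bg ->] /imsetP[C Cg ->] BC.
  have {}BC : B != C by apply: contraNneq BC => ->.
  have := trivIsetP tg _ _ Bg Cg BC; rewrite -!setI_eq0 => /eqP BC0.
  by rewrite -imsetI ?BC0 ?imset0 //; move=> ? ? _ _; apply: perm_inj.
- by move=> _ /imsetP[B Bg ->]; rewrite sI // gZ.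
move=> _ /imsetP[B Bg ->]; have [x xX xB] := gX B Bg; exists x => //.
rewrite sE s_fix //; first by apply: contraNneq yX => <-.
by apply: contraNneq zX => <-.
Qed.

(** By symmetry all points outside [X :|: Z] are covered equally often, and each transversal covers
    [#|X| * k.-1] of them. *)
Lemma card_transversals_through X Z y : [disjoint X & Z] -> y \notin X :|: Z ->
  #|[set g in transversals X Z | y \in cover g]| * (n - #|X| - #|Z|) =
  #|transversals X Z| * (#|X| * k.-1).
Proof.
move=> dXZ yXZ.
have -> : n - #|X| - #|Z| = #|~: (X :|: Z)|.
  by rewrite [RHS]cardsCs setCK cardsU (disjoint_setI0 dXZ) cards0 card_ord; lia.
rewrite mulnC -sum_nat_const.
rewrite (eq_bigr (fun z => \sum_(g in transversals X Z | z \in cover g) 1)); last first.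
  move=> z; rewrite inE => zXZ; apply/eqP; rewrite eqn_leq sum1dep_card.
  by rewrite !transversals_through_le.
rewrite (exchange_big_dep (mem (transversals X Z))) => [|z g _ /andP[]//] /=.
rewrite -sum_nat_const; apply: eq_bigr => g gT.
have /transversalsP[sg cg tg gZ gX] := gT.
have cov : #|cover g| = #|X| * k.
  rewrite -cg; have gP : g \in packings #|g| (ksubsets n k) by apply/packingsP.
  by apply: card_cover_packing gP => A; rewrite inE => /eqP.
rewrite sum1dep_card (_ : [set z | _] = cover g :\: X).
  by rewrite cardsD (setIidPr (transversals_cover gT)) cov -{1}(prednK k0) mulnS addKn.
apply/setP => z; rewrite in_set in_setC in_setD in_setU gT /= negb_or.
have [zX|zX] //= := boolP (z \in X); have [zg|] := boolP (z \in cover g); rewrite ?andbF //.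
case/bigcupP: zg => B /gZ dB zB; by rewrite (disjointFr dB zB).
Qed.

(** A common transversal covers some point of [X'] outside [X], which is a rare event by
    [card_transversals_through]. *)
Lemma card_transversalsI X X' Z : [disjoint X & Z] -> [disjoint X' & Z] ->
  #|X'| = #|X| -> X' != X ->
  #|transversals X Z :&: transversals X' Z| * (n - #|X| - #|Z|) <=
  #|transversals X Z| * (#|X| * k.-1).
Proof.
move=> dX dX' cX XX'.
have : ~~ (X' \subset X) by apply: contra XX' => s; rewrite eqEcard s cX /=.
case/subsetPn => y yX' yX.
have yXZ : y \notin X :|: Z by rewrite inE negb_or yX (disjointFr dX' yX').
rewrite -(card_transversals_through dX yXZ) leq_mul2r; apply/orP; right.
apply/subset_leq_card/subsetP => g /setIP[gT gT']; rewrite in_set gT.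
exact: (subsetP (transversals_cover gT')).
Qed.

End Transversals.

(** * Numerical parameters of the threshold *)

Definition star_pairs (r n k : nat) : nat := ('C(n, r - 1) * 'C(n - r + 1, k))%N.

Definition critical_degree (r n k : nat) : nat :=
  (\prod_(1 <= i < r) 'C(n - i * k - (r - i), k - 1))%N.

(** Both sides count the disjoint pairs of an [(r - 1)]-set and a k-set. *)
Lemma star_pairsC r n k : (0 < r)%N -> (r + k <= n)%N ->
  star_pairs r n k = ('C(n, k) * 'C(n - k, r - 1))%N.
Proof.
move=> r0 rkn; rewrite /star_pairs.
have -> : (n - r + 1 = n - (r - 1))%N by lia.
set s := (r - 1)%N; have sk : (s + k <= n)%N by rewrite /s; lia.
have E1 := @bin_fact n s ltac:(lia).
have E2 := @bin_fact (n - s) k ltac:(lia).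
have E3 := @bin_fact n k ltac:(lia).
have E4 := @bin_fact (n - k) s ltac:(lia).
have Es : (n - s - k = n - k - s)%N by lia.
rewrite Es in E2.
have K : (0 < s`! * k`! * (n - k - s)`!)%N by rewrite !muln_gt0 !fact_gt0.
apply/eqP; rewrite -(eqn_pmul2r K); apply/eqP.
transitivity n`!.
  rewrite -E1 -E2; nia.
rewrite -E3 -E4; nia.
Qed.

Lemma bin_le_star_pairs r n k : (0 < r)%N -> (r + k <= n)%N ->
  ('C(n, k) <= star_pairs r n k)%N.
Proof.
move=> r0 rkn; rewrite star_pairsC // leq_pmulr // bin_gt0; lia.
Qed.

Lemma leq_bin n k : (0 < k < n)%N -> (n <= 'C(n, k))%N.
Proof.
elim: n k => // n IH [//|k] /andP[_ kn].
rewrite binS; case: k kn => [|k] kn; first by rewrite bin1 bin0 addn1.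
have [kn'|kn'] := ltnP k.+2 n.
  have := IH k.+2; rewrite kn' => /(_ isT); have : (0 < 'C(n, k.+1))%N by rewrite bin_gt0; lia.
  lia.
have -> : n = k.+2 by lia.
by rewrite binn binSn; lia.
Qed.

Lemma critical_degree_le r n k : (0 < k)%N ->
  (critical_degree r n k <= 'C(n.-1, k.-1) ^ r.-1)%N.
Proof.
move=> k0; rewrite /critical_degree -[r.-1]subn1 -prod_nat_const_nat.
rewrite big_nat_cond [leqRHS]big_nat_cond; apply: leq_prod => i /andP[/andP[i1 ir] _].
rewrite subn1 leq_bin2l //; nia.
Qed.

Lemma critical_degree_gt0 r n k : (r * k + r <= n)%N -> (0 < critical_degree r n k)%N.
Proof.
move=> H; rewrite /critical_degree big_nat_cond; apply: prodn_cond_gt0 => i.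
move=> /andP[/andP[i1 ir] _]; rewrite bin_gt0.
have : (i * k + k <= r * k)%N by nia.
lia.
Qed.

(** * Edges created by adding one set to a union of stars *)

Section OneMoreSet.
Variables (r n k : nat).
Hypotheses (r2 : 2 <= r) (k0 : 0 < k) (rkn : r + k <= n).
Implicit Types (X A : {set 'I_n}).
Local Notation V := (ksubsets n k).

Definition star_edges X A : {set {set {set 'I_n}}} :=
  [set A |: g | g in transversals k X A].

Lemma transversals_notin X A g : A != set0 -> g \in transversals k X A -> A \notin g.
Proof.
move=> A0 /transversalsP[_ _ _ gA _]; apply/negP => /gA.
by rewrite -setI_eq0 setIid (negbTE A0).
Qed.

Lemma star_edges_inj X X' A : A != set0 ->
  {in transversals k X A & transversals k X' A, injective (fun g => A |: g)}.
Proof.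
move=> A0 g h /(transversals_notin A0) Ag /(transversals_notin A0) Ah E.
by rewrite -(setU1K Ag) E setU1K.
Qed.

Lemma star_edges_sub X A : #|X| = r.-1 -> A \in V ->
  star_edges X A \subset kneser_edges r n k.
Proof.
move=> cX AV; apply/subsetP => _ /imsetP[g gT ->].
have A0 := ksubset_nonempty k0 AV.
have Ag := transversals_notin A0 gT.
have /transversalsP[sg cg tg gA _] := gT.
have g0 : set0 \notin g by apply/negP => /(subsetP sg)/(ksubset_nonempty k0); rewrite eqxx.
have dA (C : {set 'I_n}) : C \in g -> [disjoint A & C] by move=> /gA; rewrite disjoint_sym.
have [tAg _] := trivIsetU1 dA tg g0.
by rewrite inE subUset sub1set AV sg tAg cardsU1 Ag cg cX andbT /= add1n; apply/eqP; lia.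
Qed.

Lemma card_star_edges X A : #|X| = r.-1 -> A \in V -> [disjoint X & A] ->
  #|star_edges X A| = critical_degree r n k.
Proof.
move=> cX AV dXA; have A0 := ksubset_nonempty k0 AV.
rewrite /star_edges card_in_imset; last exact: star_edges_inj.
rewrite card_transversals // cX.
have -> : #|A| = k by move: AV; rewrite inE => /eqP.
rewrite /critical_degree -[r in RHS](@prednK r) ?big_add1 /=; last by lia.
rewrite !big_nat; apply: eq_bigr => i /andP[_ ir].
by congr 'C(_, _); rewrite mulSn; lia.
Qed.

(** An edge inside the union of stars enlarged by [A] must use [A], since [r] disjoint sets cannot
    all meet [r - 1] points; its other members form a transversal, so it lies in
    [star_edges X A]. *)
Lemma star_edges_not_alpha X A (H : {set {set {set 'I_n}}}) :
  H \subset kneser_edges r n k -> #|X| = r.-1 -> A \in V -> [disjoint X & A] ->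
  [disjoint star_edges X A & H] -> ~~ alpha_is_star_size r n k H.
Proof.
move=> HE cX AV dXA dH; rewrite /alpha_is_star_size neq_ltn; apply/orP; right.
have AS : A \notin star_union k X by rewrite in_star_union AV disjoint_sym dXA.
have rn : 0 < r <= n by lia.
have iA : independent V H (A |: star_union k X).
  apply/(independentP _ HE); split.
    rewrite subUset sub1set AV; apply/subsetP => B; by rewrite in_star_union => /andP[].
  rewrite disjoint_subset; apply/subsetP => e /packingsP[es ce te]; rewrite inE.
  have eX B : B \in e -> B != A -> B \in V /\ ~~ [disjoint B & X].
    move=> /(subsetP es)/setU1P[->|]; first by rewrite eqxx.
    by rewrite in_star_union => /andP.
  have [Ae|Ae] := boolP (A \in e); last first.
    have : #|e| <= #|X|.
      apply: card_trivIset_meet => // B Be.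
      by have [] := eX B Be (contraNneq (fun E => eq_ind _ (fun C => C \in e) Be _ E) Ae).
    rewrite cX ce; lia.
  apply/negP => eH; suff : e \in star_edges X A by move/(disjointFr dH); rewrite eH.
  apply/imsetP; exists (e :\ A); last by rewrite setD1K.
  apply/transversalsP; split.
  - by apply/subsetP => B /setD1P[BA Be]; have [] := eX B Be BA.
  - by rewrite cX -ce (cardsD1 A e) Ae.
  - by apply: trivIsetS te; apply: subsetDl.
  - by move=> B /setD1P[BA Be]; apply: (trivIsetP te).
  move=> B /setD1P[BA Be]; have [_] := eX B Be BA.
  by rewrite -setI_eq0 => /set0Pn[x /setIP[xB xX]]; exists x.
have := leq_bigmax_cond (F := fun S : {set {set 'I_n}} => #|S|) _ iA.
by rewrite cardsU1 AS (star_sizeE k rn cX) add1n.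
Qed.

(** In an edge of [star_edges X A], the set [A] is the only member that does not meet [U], so the
    edge determines [A]. *)
Lemma star_edges_disjoint (U : {set 'I_n}) X X' A A' :
  X \subset U -> X' \subset U -> [disjoint A & U] -> [disjoint A' & U] -> A != A' ->
  [disjoint star_edges X A & star_edges X' A'].
Proof.
move=> XU XU' dA dA' AA'; rewrite disjoint_subset; apply/subsetP => _ /imsetP[g gT ->].
rewrite inE; apply/negP => /imsetP[g' gT' E].
have : A' \in A |: g by rewrite E setU11.
case/setU1P => [EA|A'g]; first by rewrite EA eqxx in AA'.
have /transversalsP[_ _ _ _ /(_ _ A'g)[x xX xA']] := gT.
by have := subsetP XU _ xX; rewrite (disjointFr dA' xA').
Qed.

Lemma card_star_edgesI X X' A : #|X| = r.-1 -> #|X'| = r.-1 -> A \in V ->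
  [disjoint X & A] -> [disjoint X' & A] -> X != X' ->
  #|star_edges X A :&: star_edges X' A| * (n - r.-1 - k) <=
  critical_degree r n k * (r.-1 * k.-1).
Proof.
move=> cX cX' AV dX dX' XX'; have A0 := ksubset_nonempty k0 AV.
have Ak : #|A| = k by move: AV; rewrite inE => /eqP.
have := @card_transversalsI n k k0 X X' A dX dX'; rewrite cX cX' Ak eq_sym => /(_ erefl XX').
have -> : #|transversals k X A| = critical_degree r n k.
  rewrite -(card_star_edges cX AV dX) /star_edges card_in_imset //; exact: star_edges_inj.
apply: leq_trans; rewrite leq_mul2r; apply/orP; right.
rewrite -(card_in_imset (f := fun g => A |: g)
  (D := mem (transversals k X A :&: transversals k X' A))); last first.
  move=> g h /setIP[gT _] /setIP[hT _]; exact: star_edges_inj gT hT.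
apply/subset_leq_card/subsetP => e /setIP[/imsetP[g gT Eg] /imsetP[h hT Eh]].
apply/imsetP; exists g => //; rewrite inE gT /=.
suff -> : g = h by [].
by apply: (star_edges_inj A0 gT hT); rewrite -Eg -Eh.
Qed.

End OneMoreSet.

(** * Elementary bounds on binomial coefficients *)

Lemma bin_le_exp2 n m : 'C(n, m) <= 2 ^ n.
Proof.
elim: n m => [|n IH] [|m]; rewrite ?bin0 ?bin0n ?expn_gt0 //.
by rewrite binS expnS mul2n -addnn leq_add.
Qed.

Lemma bin_le_exp n m : 'C(n, m) <= n ^ m.
Proof.
elim: n m => [|n IH] [|m]; rewrite ?bin0 ?bin0n ?expn0 //.
rewrite binS expnS mulSn addnC leq_add //.
  by apply: leq_trans (IH m) (leq_expl _ _).
by apply: leq_trans (IH m.+1) _; rewrite expnS leq_mul2l leq_expl ?orbT.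
Qed.

Lemma exp_le_bin_fact m j : (m - j) ^ j <= 'C(m, j) * j`!.
Proof.
rewrite bin_ffact; elim: j => [|j IH]; first by rewrite expn0 ffactn0.
rewrite expnSr ffactnSr leq_mul //; last by lia.
by apply: leq_trans IH; apply: leq_expl; lia.
Qed.

Lemma leq_bin2r m i j : i <= j -> 2 * j <= m.+1 -> 'C(m, i) <= 'C(m, j).
Proof.
elim: j => [|j IH]; first by rewrite leqn0 => /eqP ->.
rewrite leq_eqVlt => /predU1P[->//|]; rewrite ltnS => ij jm.
apply: (@leq_trans 'C(m, j)); first by apply: IH; lia.
by rewrite -(leq_pmul2l (ltn0Sn j)) mul_bin_left leq_mul2r; apply/orP; right; lia.
Qed.

Lemma star_pairs_le_exp r n k : 0 < r <= n -> star_pairs r n k <= n ^ (r - 1 + k).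
Proof.
move=> rn; rewrite expnD leq_mul ?bin_le_exp //.
apply: leq_trans (bin_le_exp _ _) _; apply: leq_expl; lia.
Qed.

Lemma star_pairs_le_exp4 r n k : 0 < r <= n -> star_pairs r n k <= 4 ^ n.
Proof.
move=> rn; rewrite -[4]/(2 * 2) expnMn leq_mul ?bin_le_exp2 //.
apply: leq_trans (bin_le_exp2 _ _) _; rewrite leq_exp2l //; lia.
Qed.

(** Only the factor of index 1 is kept. The last hypothesis is [n >= r (k + 1/2)] cleared of its
    fraction; it makes the other factors positive. *)
Lemma critical_degree_ge r n k : 1 < r -> 0 < k -> r * k.*2.+1 <= n.*2 ->
  'C(n - k - (r - 1), k - 1) <= critical_degree r n k.
Proof.
move=> r2 k0 H; rewrite /critical_degree big_ltn // mul1n leq_pmulr //.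
rewrite big_nat_cond; apply: prodn_cond_gt0 => i /andP[/andP[i1 ir] _].
rewrite bin_gt0.
have : (r - i) * k.*2.+1 + i * k.*2.+1 <= n.*2 by rewrite -mulnDl subnK // ltnW.
have : r - i <= (r - i) * k.*2.+1 by rewrite leq_pmulr.
nia.
Qed.

Lemma four_pow_le_central k : 4 ^ k <= (2 * k).+1 * 'C(2 * k, k).
Proof.
have -> : 4 ^ k = \sum_(i < (2 * k).+1) 'C(2 * k, i).
  have := expnDn 1 1 (2 * k); rewrite -[1 + 1]/2 expnM -[2 ^ 2]/4 => ->.
  by apply: eq_bigr => i _; rewrite !exp1n !muln1.
apply: (@leq_trans (\sum_(i < (2 * k).+1) 'C(2 * k, k))); last first.
  by rewrite sum_nat_const card_ord.
apply: leq_sum => i _.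
have [ik|ki] := leqP i k; first by apply: leq_bin2r => //; lia.
have i2 : i <= 2 * k by rewrite -ltnS.
by rewrite -(bin_sub i2); apply: leq_bin2r; lia.
Qed.

From mathcomp Require Import all_order all_algebra reals sequences exp ring lra.
Import Order.TTheory GRing.Theory Num.Theory.
Local Open Scope ring_scope.

(** * Random subsets of a finite set *)

Section RandomSubset.
Variables (R : realType) (T : finType) (E : {set T}) (p : R).
Hypothesis p01 : 0 <= p <= 1.
Implicit Types (H A : {set T}) (P Q : pred {set T}).

Let w (q : R) H := \prod_(e in E) (if e \in H then q else 1 - q).
Let q := 1 - p.
Local Notation Pr P := (random_subset_pr E p P).

Lemma random_subset_weight_ge0 H : 0 <= w p H.
Proof. by apply: prodr_ge0 => e _; case: ifP; move: p01; lra. Qed.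

Lemma random_subset_pr_ge0 P : 0 <= Pr P.
Proof. by apply: sumr_ge0 => H _; apply: random_subset_weight_ge0. Qed.

Lemma random_subset_prE P : Pr P = \sum_(H : {set T} | H \subset E) w p H * (P H)%:R.
Proof.
rewrite /random_subset_pr big_mkcondr /=; apply: eq_bigr => H _.
by case: (P H); rewrite ?mulr1 ?mulr0.
Qed.

Lemma random_subset_weight_sum : \sum_(H : {set T} | H \subset E) w p H = 1.
Proof.
have := @random_subset_pr_sup R T set0 E p (sub0set _).
rewrite cards0 expr0 random_subset_prE => <-; apply: eq_bigr => H _.
by rewrite sub0set mulr1.
Qed.

Lemma le_random_subset_pr P Q :
  (forall H, H \subset E -> P H -> Q H) -> Pr P <= Pr Q.
Proof.
move=> PQ; rewrite !random_subset_prE; apply: ler_sum => H HE.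
rewrite ler_wpM2l ?random_subset_weight_ge0 //.
by have := PQ H HE; case: (P H) => [->|_]; rewrite ?ler_nat.
Qed.

Lemma random_subset_prC P : Pr P = 1 - Pr (predC P).
Proof.
rewrite -random_subset_weight_sum !random_subset_prE -sumrB; apply: eq_bigr => H _ /=.
by case: (P H); rewrite ?mulr1 ?mulr0 ?subr0 ?subrr.
Qed.

Lemma random_subset_pr_le1 P : Pr P <= 1.
Proof. by rewrite random_subset_prC gerBl random_subset_pr_ge0. Qed.

Lemma random_subset_pr_union (I : finType) (J : pred I) (P : I -> pred {set T}) :
  Pr (fun H => [exists i, J i && P i H]) <= \sum_(i | J i) Pr (P i).
Proof.
rewrite random_subset_prE (eq_bigr (fun i => \sum_(H : {set T} | H \subset E) w p H * (P i H)%:R)) => [|i _]; last first.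
  exact: random_subset_prE.
rewrite exchange_big /=; apply: ler_sum => H HE; rewrite -mulr_sumr.
rewrite ler_wpM2l ?random_subset_weight_ge0 //.
case: existsP => [[i /andP[Ji Pi]]|_]; last by apply: sumr_ge0 => i _; rewrite ler0n.
rewrite (bigD1 i) //= Pi lerDl; apply: sumr_ge0 => j _; exact: ler0n.
Qed.

(** Complementation in [E] exchanges [p] and [q], which reduces the claim to
    [random_subset_pr_sup]. *)
Lemma random_subset_pr_disjoint A : A \subset E ->
  Pr (fun H => [disjoint A & H]) = q ^+ #|A|.
Proof.
move=> AE; rewrite -(random_subset_pr_sup q AE) /random_subset_pr.
rewrite (reindex_onto (fun H => E :\: H) (fun H => E :\: H)) /=; last first.
  by move=> H /andP[HE _]; rewrite setDDr setDv set0U; apply/setIidPr.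
apply: eq_big => [H|H].
  rewrite subsetDl /= setDDr setDv set0U.
  rewrite (sameP eqP setIidPr) andbC; congr (_ && _).
  by rewrite -setI_eq0 setIDA (setIidPl AE) setD_eq0.
move=> /andP[_ /eqP EH]; apply: eq_bigr => e eE; rewrite inE eE andbT /q.
by case: (e \in H) => //=; rewrite opprB addrC subrK.
Qed.

(** Chebyshev's inequality for the number [Y] of those [ev j] that [H] misses: its mean is [m], the
    right-hand side is its variance, and the squared deviation is [m ^ 2] when [Y] vanishes. *)
Lemma random_subset_second_moment (I : finType) (J : {set I}) (ev : I -> {set T}) d :
  (forall j, j \in J -> ev j \subset E) -> (forall j, j \in J -> #|ev j| = d) ->
  Pr (fun H => [forall j in J, ~~ [disjoint ev j & H]]) * (#|J|%:R * q ^+ d) ^+ 2 <=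
  \sum_(i in J) \sum_(j in J) (q ^+ #|ev i :|: ev j| - q ^+ d * q ^+ d).
Proof.
move=> evE evd; set m := #|J|%:R * q ^+ d.
pose Y H : R := \sum_(j in J) [disjoint ev j & H]%:R.
have EY : \sum_(H : {set T} | H \subset E) w p H * Y H = m.
  under eq_bigr do rewrite mulr_sumr.
  rewrite exchange_big /= /m mulr_natl -sumr_const; apply: eq_bigr => j jJ.
  by rewrite -(evd j jJ) -random_subset_pr_disjoint ?evE // random_subset_prE.
have EY2 : \sum_(H : {set T} | H \subset E) w p H * (Y H * Y H) =
    \sum_(i in J) \sum_(j in J) q ^+ #|ev i :|: ev j|.
  under eq_bigr do rewrite [Y _ * _]mulr_suml mulr_sumr.
  rewrite exchange_big /=; apply: eq_bigr => i iJ.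
  under eq_bigr do rewrite mulr_sumr mulr_sumr.
  rewrite exchange_big /=; apply: eq_bigr => j jJ.
  rewrite -random_subset_pr_disjoint ?random_subset_prE ?subUset ?evE //.
  apply: eq_bigr => H _; congr (_ * _).
  rewrite -natrM mulnb; congr (nat_of_bool _)%:R.
  by rewrite -[RHS]setI_eq0 setIUl setU_eq0 !setI_eq0.
have -> : \sum_(i in J) \sum_(j in J) (q ^+ #|ev i :|: ev j| - q ^+ d * q ^+ d) =
    \sum_(H : {set T} | H \subset E) w p H * (Y H - m) ^+ 2.
  under [RHS]eq_bigr => H _.
    rewrite (_ : w p H * (Y H - m) ^+ 2 =
      w p H * (Y H * Y H) + (- (2 * m) * (w p H * Y H) + m * m * w p H)); last by ring.
    over.
  rewrite !big_split /= -!mulr_sumr EY EY2 random_subset_weight_sum.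
  under eq_bigr do rewrite sumrB.
  rewrite sumrB.
  have -> : \sum_(i in J) \sum_(j in J) q ^+ d * q ^+ d = m * m.
    by rewrite !sumr_const -(mulr_natl (_ *+ _)) -(mulr_natl (_ * _)) mulrA mulrACA.
  by ring.
rewrite random_subset_prE mulr_suml; apply: ler_sum => H _.
rewrite -mulrA ler_wpM2l ?random_subset_weight_ge0 //.
case: forall_inP => [Hj|_]; last by rewrite mul0r sqr_ge0.
rewrite mul1r /Y big1 => [|j /Hj/negbTE -> //].
by rewrite sub0r sqrrN.
Qed.

(** Second moment over the pairs [(i, j)]. Distinct [j] give independent events, hence no
    covariance. For equal [j] and distinct [i], [L] bounds the inverse of the probability of missing
    the common part, so the covariance is at most [q ^+ d * q ^+ d * L]. These pairs give the second
    term and the diagonal gives the first. *)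
Lemma random_subset_pr_none (I1 I2 : finType) (J1 : {set I1}) (J2 : {set I2})
    (ev : I1 -> I2 -> {set T}) d (L : R) :
  0 < q -> (0 < #|J1|)%N -> (0 < #|J2|)%N -> 0 <= L ->
  (forall i j, i \in J1 -> j \in J2 -> ev i j \subset E) ->
  (forall i j, i \in J1 -> j \in J2 -> #|ev i j| = d) ->
  (forall i i' j j', i \in J1 -> i' \in J1 -> j \in J2 -> j' \in J2 -> j != j' ->
     [disjoint ev i j & ev i' j']) ->
  (forall i i' j, i \in J1 -> i' \in J1 -> j \in J2 -> i != i' ->
     1 <= q ^+ #|ev i j :&: ev i' j| * L) ->
  Pr (fun H => [forall i in J1, forall j in J2, ~~ [disjoint ev i j & H]]) <=
    (#|J1|%:R * #|J2|%:R * q ^+ d)^-1 + L / #|J2|%:R.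
Proof.
move=> q0 J10 J20 L0 evE evd evj evi.
pose J := finset.setX J1 J2.
have JP ij : ij \in J -> ij.1 \in J1 /\ ij.2 \in J2.
  by case: ij => i j; rewrite in_setX => /andP.
have cJ : #|J|%:R = #|J1|%:R * #|J2|%:R :> R by rewrite cardsX natrM.
have H2 : Pr (fun H => [forall ij in J, ~~ [disjoint ev ij.1 ij.2 & H]]) *
      (#|J|%:R * q ^+ d) ^+ 2 <=
    \sum_(i in J) \sum_(j in J)
      (q ^+ #|ev i.1 i.2 :|: ev j.1 j.2| - q ^+ d * q ^+ d).
  by apply: random_subset_second_moment => ij /JP[? ?]; [apply: evE|apply: evd].
set a := q ^+ d in H2 *; have a0 : 0 < a by apply: exprn_gt0.
have n1 : 0 < #|J1|%:R :> R by rewrite ltr0n.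
have n2 : 0 < #|J2|%:R :> R by rewrite ltr0n.
set N1 : R := #|J1|%:R in cJ n1 *; set N2 : R := #|J2|%:R in cJ n2 *.
have H3 : \sum_(i in J) \sum_(j in J)
      (q ^+ #|ev i.1 i.2 :|: ev j.1 j.2| - a * a) <=
    N1 * N2 * (a + N1 * (a * a * L)).
  rewrite -cJ mulr_natl -sumr_const; apply: ler_sum => -[i j] /JP[/= iJ jJ].
  apply: (@le_trans _ _ (\sum_(ij in J) ((ij == (i, j))%:R * a +
      (ij.2 == j)%:R * (a * a * L)))).
    apply: ler_sum => -[i' j'] /JP[/= iJ' jJ']; rewrite xpair_eqE.
    have cU := cardsUI (ev i j) (ev i' j').
    rewrite !evd // in cU.
    have [Ej|Nj] := eqVneq j' j; last first.
      rewrite andbF !mul0r addr0 (_ : #|_| = (d + d)%N) ?exprD ?subrr //.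
      by rewrite -cU disjoint_setI0 ?cards0 ?addn0 // evj // eq_sym.
    rewrite andbT mul1r; have [Ei|Ni] := eqVneq i' i.
      rewrite Ei Ej setUid evd // mul1r -/a.
      have : 0 <= a * a * L by rewrite !mulr_ge0 // ltW.
      have : 0 <= a * a by rewrite mulr_ge0 // ltW.
      lra.
    rewrite mul0r add0r.
    have : a * a = q ^+ #|ev i j :|: ev i' j'| * q ^+ #|ev i j :&: ev i' j'|.
      by rewrite -!exprD cU.
    rewrite Ej; have := evi i i' j iJ iJ' jJ; rewrite eq_sym Ni => /(_ isT).
    set u := q ^+ _; set v := q ^+ _ => vL aE.
    have v0 : 0 < v by apply: exprn_gt0.
    have : v <= v * (u * L) by rewrite ler_peMr // ltW.
    have : 0 <= a * a by rewrite mulr_ge0 // ltW.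
    rewrite {3}aE; nra.
  rewrite big_split /= lerD //.
    rewrite -mulr_suml -[leRHS]mul1r ler_wpM2r ?(ltW a0) //.
    rewrite (bigD1 (i, j)) ?in_setX ?iJ //= eqxx big1 ?addr0 // => ij /andP[_ /negbTE -> //].
  rewrite -mulr_suml ler_wpM2r ?mulr_ge0 ?(ltW a0) //.
  rewrite /N1 -natr_sum ler_nat.
  have -> : (\sum_(ij in J) (ij.2 == j) = \sum_(ij in J | ij.2 == j) 1)%N.
    by rewrite [RHS]big_mkcondr; apply: eq_bigr => ij _; case: (_ == _).
  rewrite sum1dep_card -(card_imset (mem J1) (f := fun i => (i, j))) => [|? ? [] //].
  apply/subset_leq_card/subsetP => -[i' j']; rewrite !inE /= => /andP[/andP[iJ' _] /eqP ->].
  exact: imset_f.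
apply: (@le_trans _ _ (Pr (fun H => [forall ij in J, ~~ [disjoint ev ij.1 ij.2 & H]]))).
  apply: le_random_subset_pr => H _ /forall_inP HJ; apply/forall_inP => ij /JP[iJ jJ].
  by have /forall_inP := HJ _ iJ; apply.
rewrite -(@ler_pM2r _ ((N1 * N2 * a) ^+ 2)); last by rewrite exprn_gt0 // !mulr_gt0.
rewrite -cJ; apply: le_trans H2 _; apply: le_trans H3 _; rewrite cJ.
rewrite le_eqVlt; apply/orP; left; apply/eqP; field.
by rewrite !gt_eqF.
Qed.

End RandomSubset.

(** Expansion of a product over [V]: each element either agrees with [G], with weight 1, or
    disagrees, with weight [y]. *)
Lemma sum_symdiff (R : comRingType) (U : finType) (V G : {set U}) (y : R) :
  G \subset V ->
  (\sum_(F : {set U} | F \subset V) y ^+ #|(F :\: G) :|: (G :\: F)| = (1 + y) ^+ #|V|)%R.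
Proof.
move=> GV.
pose a v : R := (if v \in V then if v \in G then 1 else y else 0)%R.
pose b v : R := (if v \in V then if v \in G then y else 1 else 1)%R.
have := @bigA_distr R 0%R 1%R *%R +%R U a b.
have -> : (\prod_v (a v + b v) = (1 + y) ^+ #|V|)%R.
  rewrite (bigID (mem V)) /= [X in (_ * X)%R]big1 ?mulr1 => [|v /negbTE vV]; last first.
    by rewrite /a /b vV add0r.
  rewrite -prodr_const; apply: eq_bigr => v vV; rewrite /a /b vV.
  by case: ifP => _; rewrite // addrC.
move=> ->; rewrite [RHS](bigID (fun F : {set U} => F \subset V)) /=.
rewrite [X in (_ + X)%R]big1 ?addr0 => [|F /subsetPn[v vF vV]]; last first.
  by rewrite (bigD1 v) //= vF /a (negbTE vV) mul0r.
apply: eq_bigr => F FV; set S := _ :|: _.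
rewrite [RHS](bigID (mem S)) /= [X in (_ * X)%R]big1 ?mulr1 => [|v]; last first.
  rewrite /S !inE /a /b; have [vF|vF] := boolP (v \in F).
    by rewrite (subsetP FV) // andbT orbF; case: (v \in G).
  by rewrite andbF andTb orFb => /negbTE ->; case: ifP.
rewrite -prodr_const; apply: eq_bigr => v; rewrite /S !inE /a /b.
have [vF|vF] := boolP (v \in F); first by rewrite (subsetP FV) // andbT orbF => /negbTE ->.
by rewrite andbF /= => vG; rewrite (subsetP GV) // vG.
Qed.

Lemma expr1D_le (R : realFieldType) (y : R) m :
  (0 <= y -> 2 * m%:R * y <= 1 -> (1 + y) ^+ m <= 1 + 2 * m%:R * y)%R.
Proof.
move=> y0; elim: m => [|m IH]; first by rewrite expr0 mulr0 mul0r addr0.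
move=> H; have y1 : (m%:R * y >= 0 :> R)%R by rewrite mulr_ge0.
move: H; rewrite -natr1 => H.
have := IH ltac:(nra); rewrite exprS => {}IH.
apply: (@le_trans _ _ ((1 + y) * (1 + 2 * m%:R * y)))%R; last by nra.
by rewrite ler_wpM2l //; lra.
Qed.

(** * Supercritical regime *)

Lemma critical_pE (R : realType) r n k :
  critical_p R r n k = ln (star_pairs r n k)%:R / (critical_degree r n k)%:R.
Proof. by []. Qed.

Lemma one_sub_expR (R : realType) (p : R) e : 0 <= p <= 1 -> (1 - p) ^+ e <= expR (- (p * e%:R)).
Proof.
move=> p01; rewrite -mulNr expRM_natr; apply: lerXn2r; rewrite ?nnegrE ?expR_ge0 //.
  by lra.
exact: expR_ge1Dx.
Qed.

Lemma le_sqr2 (R : realFieldType) (z : R) : 2 <= z -> 2 <= z ^+ 2.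
Proof. by rewrite expr2; nra. Qed.

Section UnionBound.
Variables (R : realType) (r n k : nat) (p : R).
Hypotheses (r2 : (2 <= r)%N) (k2 : (2 <= k)%N) (nk : ((24 * r) ^ 3 * k ^ 3 <= n)%N).
Hypotheses (p01 : 0 <= p <= 1) (pc : 6 * (Gamma r)%:R * critical_p R r n k < p).
Local Notation V := (ksubsets n k).
Local Notation N := (star_pairs r n k).

Let rkn : (r * k + r <= n)%N.
Proof.
apply: leq_trans nk; have : (r * k <= r ^ 3 * k ^ 3)%N.
  by apply: leq_mul; rewrite -[leqLHS]expn1 leq_pexp2l //; lia.
have : (r <= r * k)%N by rewrite leq_pmulr //; lia.
rewrite expnMn; lia.
Qed.

Let nN : (n <= N)%N.
Proof.
have rk : (r + k <= n)%N by nia.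
apply: leq_trans (bin_le_star_pairs _ rk); last by lia.
by apply: leq_bin; nia.
Qed.

(* The exponent [3] makes the total weight of the families at distance [b > 0]
   from one of the ['C(n, r - 1)] unions of stars [O(1 / N)]. *)
Lemma non_star_union_pr (X : {set 'I_n}) (F : {set {set 'I_n}}) :
  F \subset V -> #|F| = star_size r n k -> #|X| = r.-1 ->
  (#|F :\: star_union k X| * 'C(n.-1, k.-1) ^ r.-1 <= Gamma r * #|packings r F|)%N ->
  random_kneser_pr r n k p (fun H => [disjoint packings r F & H]) <=
  (N%:R ^- 3) ^+ #|(F :\: star_union k X) :|: (star_union k X :\: F)|.
Proof.
move=> FV cF cX Hp; rewrite /random_kneser_pr random_subset_pr_disjoint; last first.
  apply/subsetP => e; rewrite !inE => /and3P[eF -> ->]; rewrite !andbT.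
  exact: subset_trans eF FV.
have n0 : (0 < n)%N by nia.
have N0 : 0 < N%:R :> R by rewrite ltr0n; lia.
have N1 : 0 <= ln (N%:R : R) by rewrite ln_ge0 // ler1n; lia.
set b := #|F :\: star_union k X| in Hp *.
have cG := star_sizeE k (r := r) (X := X) ltac:(lia) cX.
have cb : #|star_union k X :\: F| = b.
  by rewrite /b !cardsD cG cF setIC.
(* [F] and the union of stars have equal sizes, so their symmetric difference has [2 * b] elements
   and the bound to reach is [N ^ (- 6 b)], whence the factor 6 in [pc]. *)
rewrite cardsU cb (_ : _ :&: _ = set0) ?cards0 ?subn0; last first.
  by apply/setP => A; rewrite !inE; case: (A \in F); rewrite ?andbF.
rewrite -/b addnn -mul2n -exprVn -!exprM mulnA.
have -> : N%:R^-1 = expR (- ln N%:R) :> R by rewrite expRN lnK ?posrE.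
apply: le_trans (one_sub_expR _ p01) _.
rewrite -expRM_natr ler_expR mulNr lerN2.
have D0 : 0 < (critical_degree r n k)%:R :> R by rewrite ltr0n critical_degree_gt0.
have Hn : (b * critical_degree r n k <= Gamma r * #|packings r F|)%N.
  by apply: leq_trans Hp; rewrite leq_mul2l critical_degree_le ?orbT //; lia.
move: pc Hn; rewrite critical_pE; set NR : R := N%:R in N0 N1 *.
rewrite mulrA ltr_pdivrMr // -(ler_nat R).
rewrite (natrM _ b) (natrM _ (Gamma r)) (natrM _ (3 * 2) b).
have G0 : 0 < (Gamma r)%:R :> R by rewrite ltr0n /Gamma muln_gt0 expn_gt0; lia.
set D : R := (critical_degree r n k)%:R in D0 *; set G : R := (Gamma r)%:R in G0 *.
set L := ln _ in N1 *; set e : R := #|_|%:R; set bb : R := b%:R => pD be.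
have b0 : 0 <= bb by rewrite ler0n.
rewrite -(ler_pM2l G0).
apply: (@le_trans _ _ (bb * (6 * G * L))); first by lra.
apply: (@le_trans _ _ (bb * (p * D))); first by rewrite ler_wpM2l //; lra.
have -> : bb * (p * D) = p * (bb * D) by ring.
have -> : G * (p * e) = p * (G * e) by ring.
by rewrite ler_wpM2l //; case/andP: p01.
Qed.

(** Union bound over the pairs provided by [supersaturation]. For each center the total weight is at
    most [(1 + y) ^ #|V| - 1], hence at most [2 / N ^ 2]; there are at most [N] centers, and
    [n <= N]. *)
Lemma only_star_unions_pr :
  1 - 2 / n%:R <= random_kneser_pr r n k p (only_star_unions r n k).
Proof.
rewrite /random_kneser_pr random_subset_prC lerD2l lerN2.
pose J := [pred XF : {set 'I_n} * {set {set 'I_n}} |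
  [&& #|XF.1| == r.-1, XF.2 \subset V, XF.2 != star_union k XF.1,
   #|XF.2| == star_size r n k &
   (#|XF.2 :\: star_union k XF.1| * 'C(n.-1, k.-1) ^ r.-1 <= Gamma r * #|packings r XF.2|)%N]].
have rk : (r + k <= n)%N by nia.
apply: (@le_trans _ _ (random_subset_pr (kneser_edges r n k) p
    (fun H => [exists XF, J XF && [disjoint packings r XF.2 & H]]))).
  apply: le_random_subset_pr => // H HE /=; rewrite negb_forall => /existsP[F Fbad].
  have [/andP[iF /eqP cF]|nF] := boolP (independent V H F && (#|F| == star_size r n k)).
    have [FV dF] := independentP F HE iF.
    have [X cX HX] := supersaturation r2 k2 nk FV cF.
    apply/existsP; exists (X, F); rewrite /= cX FV cF HX !eqxx dF /= !andbT.
    apply: contra Fbad => /eqP EF; rewrite iF cF eqxx /=.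
    by apply/eqP/esym/existsP; exists X; rewrite cX subn1 eqxx EF eqxx.
  (* The other way to fail, a union of [r - 1] stars that is dependent or has the wrong size, never
     occurs. *)
  move: Fbad; rewrite (negbTE nF) => Fbad; case/negP: nF.
  have /existsP[X /andP[/eqP cX /eqP ->]] : [exists X : {set 'I_n},
     (#|X| == (r - 1)%N) && (F == \bigcup_(x in X) star k x)].
    by move: Fbad; case: [exists X, _].
  rewrite subn1 in cX; apply/andP; split; first exact: (independent_star_union r2 k2 rk HE cX).
  by apply/eqP; apply: star_sizeE cX; lia.
apply: le_trans (random_subset_pr_union _ p01 _ _) _.
have n2 : (1 < n)%N by nia.
have [M EM] : {M : nat | M = N} by exists N.
have nM : (n <= M)%N by rewrite EM.
have N0 : 0 < M%:R :> R by rewrite ltr0n; lia.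
set y : R := M%:R ^- 3; have y0 : 0 <= y by rewrite invr_ge0 exprn_ge0 ?ltW.
have VN : #|V|%:R <= M%:R :> R by rewrite card_ksubsets ler_nat EM bin_le_star_pairs //; lia.
have yN : M%:R * y = M%:R ^- 2 by rewrite /y; field; rewrite gt_eqF.
pose f (XF : {set 'I_n} * {set {set 'I_n}}) : R :=
  y ^+ #|(XF.2 :\: star_union k XF.1) :|: (star_union k XF.1 :\: XF.2)|.
apply: (@le_trans _ _ (\sum_(XF | J XF) f XF)).
  apply: ler_sum => -[X F] /and5P[/eqP cX FV _ /eqP cF HF].
  by rewrite /f /y EM; apply: non_star_union_pr.
apply: (@le_trans _ _ (\sum_(X : {set 'I_n} | #|X| == r.-1)
    \sum_(F : {set {set 'I_n}} | (F \subset V) && (F != star_union k X)) f (X, F))).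
  rewrite pair_big_dep big_mkcond [leRHS]big_mkcond; apply: ler_sum => -[X F] _.
  rewrite /J /=; case: ifP => [/and5P[cX FV FX _ _]|_]; first by rewrite cX FV FX.
  by case: ifP => // _; apply: exprn_ge0.
have HX X : \sum_(F : {set {set 'I_n}} | (F \subset V) && (F != star_union k X))
      f (X, F) <= 2 * M%:R ^- 2.
  have XV : star_union k X \subset V.
    by apply/subsetP => A; rewrite in_star_union => /andP[].
  have E := sum_symdiff y XV.
  have H2 : 2 * #|V|%:R * y <= 2 * M%:R ^- 2 by rewrite -yN mulrA ler_wpM2r // ler_wpM2l.
  have H3 : 2 * M%:R ^- 2 <= 1 :> R.
    rewrite ler_pdivrMr ?exprn_gt0 // mul1r.
    have : 2 <= M%:R :> R by rewrite ler_nat (leq_trans n2).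
    exact: le_sqr2.
  have := expr1D_le y0 (le_trans H2 H3).
  rewrite -E (bigD1 (star_union k X)) //= setDv setU0 cards0 expr0 lerD2l => H4.
  exact: le_trans H4 H2.
apply: le_trans (_ : \sum_(X : {set 'I_n} | #|X| == r.-1) 2 * M%:R ^- 2 <= _).
  by apply: ler_sum => X _; apply: HX.
have -> : \sum_(X : {set 'I_n} | #|X| == r.-1) 2 * M%:R ^- 2 =
    'C(n, r.-1)%:R * (2 * M%:R ^- 2) :> R.
  rewrite sumr_const -(mulr_natl (2 * _)); congr (_%:R * _).
  rewrite -[n in RHS]card_ord -cardsT -cards_draws; apply: eq_card => A.
  by rewrite !inE subsetT.
have CN : 'C(n, r.-1)%:R <= M%:R :> R.
  rewrite ler_nat EM /star_pairs subn1 leq_pmulr // bin_gt0; lia.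
have n0 : 0 < n%:R :> R by rewrite ltr0n; lia.
have nNR : n%:R <= M%:R :> R by rewrite ler_nat.
apply: (@le_trans _ _ (2 / M%:R)).
  have -> : 2 / M%:R = M%:R * (2 * M%:R ^- 2) :> R by field; rewrite gt_eqF.
  by rewrite ler_wpM2r // mulr_ge0 // invr_ge0 exprn_ge0 ?ltW.
by rewrite ler_wpM2l // lef_pV2 ?posrE.
Qed.

Lemma alpha_is_star_size_pr :
  random_kneser_pr r n k p (only_star_unions r n k) <=
  random_kneser_pr r n k p (alpha_is_star_size r n k).
Proof.
apply: le_random_subset_pr => // H HE; apply: only_star_unions_alpha => //; nia.
Qed.

End UnionBound.

(** * Subcritical regime *)

Section OneMoreSetProbability.
Variables (r n k : nat).
Hypotheses (r2 : (2 <= r)%N) (k0 : (0 < k)%N) (rkn : (r + k <= n)%N).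
Local Notation V := (ksubsets n k).

(** A set [U] of size [u] holds the centers, and its complement holds the added sets. [L] bounds the
    inverse probability of missing the edges common to two distinct centers; for [u = r.-1] there is
    only one center, and [L = 0] is allowed. *)
Lemma alpha_is_star_size_pr_le (R : realType) (p L : R) (u : nat) :
  0 <= p < 1 -> 0 <= L -> (r.-1 <= u)%N -> (u + k <= n)%N ->
  (forall w, (r.-1 < u)%N ->
     (w * (n - r.-1 - k) <= critical_degree r n k * (r.-1 * k.-1))%N ->
     1 <= (1 - p) ^+ w * L) ->
  random_kneser_pr r n k p (alpha_is_star_size r n k) <=
    ('C(u, r.-1)%:R * 'C(n - u, k)%:R * (1 - p) ^+ critical_degree r n k)^-1
    + L / 'C(n - u, k)%:R.
Proof.
move=> p01 L0 ru ukn HL.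
have p01' : 0 <= p <= 1 by move: p01; lra.
have un : (u <= #|[set: 'I_n]|)%N by rewrite cardsT card_ord; lia.
have [U _ cU] := exists_subset_card un.
pose J1 := [set X : {set 'I_n} | X \subset U & #|X| == r.-1].
pose J2 := [set A : {set 'I_n} | A \subset ~: U & #|A| == k].
have cJ1 : #|J1| = 'C(u, r.-1) by rewrite cards_draws cU.
have cJ2 : #|J2| = 'C(n - u, k).
  rewrite cards_draws; congr 'C(_, _).
  by have := cardsC U; rewrite cU card_ord; lia.
have J1P X : X \in J1 -> X \subset U /\ #|X| = r.-1 by rewrite inE => /andP[? /eqP].
have J2P A : A \in J2 -> [disjoint A & U] /\ A \in V.
  by rewrite !inE -disjoints_subset => /andP[].
have JX X A : X \in J1 -> A \in J2 -> [disjoint X & A].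
  move=> /J1P[XU _] /J2P[dA _]; rewrite disjoint_sym; exact: disjointWr dA.
apply: (@le_trans _ _ (random_kneser_pr r n k p (fun H =>
    [forall X in J1, forall A in J2, ~~ [disjoint star_edges k X A & H]]))).
  apply: le_random_subset_pr => // H HE Ha.
  apply/forall_inP => X X1; apply/forall_inP => A A2; apply: contraL Ha => dH.
  have [_ cX] := J1P _ X1; have [_ AV] := J2P _ A2.
  exact: (star_edges_not_alpha r2 k0 rkn HE cX AV (JX _ _ X1 A2) dH).
rewrite -cJ1 -cJ2; apply: random_subset_pr_none => //.
- by move: p01; lra.
- by rewrite cJ1 bin_gt0.
- by rewrite cJ2 bin_gt0; lia.
- by move=> X A /J1P[_ cX] /J2P[_ AV]; apply: star_edges_sub.
- move=> X A X1 A2; have [_ cX] := J1P _ X1; have [_ AV] := J2P _ A2.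
  exact: (card_star_edges r2 k0 rkn cX AV (JX _ _ X1 A2)).
- move=> X X' A A' /J1P[XU _] /J1P[XU' _] /J2P[dA _] /J2P[dA' _] AA'.
  exact: (star_edges_disjoint k XU XU' dA dA' AA').
move=> X X' A X1 X1' A2 XX'; have [XU cX] := J1P _ X1; have [XU' cX'] := J1P _ X1'.
have [_ AV] := J2P _ A2; apply: HL.
  rewrite ltnNge; apply: contra XX' => ur.
  have EX : X = U by apply/eqP; rewrite eqEcard XU cX cU.
  by rewrite EX eq_sym eqEcard XU' cX' cU.
exact: (card_star_edgesI r2 k0 rkn cX cX' AV (JX _ _ X1 A2) (JX _ _ X1' A2) XX').
Qed.

End OneMoreSetProbability.

(** * Asymptotic size of the critical probability *)

Section Asymptotics.
Variable R : realType.
Implicit Types (x y eps delta : R) (n r k : nat).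

Lemma exists_nat_ge x : exists n0, forall n, (n0 <= n)%N -> x <= n%:R.
Proof.
exists (Num.bound `|x|) => n nn; apply: le_trans (ler_norm x) _.
by apply: le_trans (ltW (archi_boundP (normr_ge0 x))) _; rewrite ler_nat.
Qed.

Lemma expR_ln_small c delta : 0 < c -> 0 < delta ->
  exists n0, forall n, (n0 <= n)%N -> expR (- (c * ln n%:R)) <= delta.
Proof.
move=> c0 d0; have [n0 Hn] := exists_nat_ge (expR (- ln delta / c)).
exists n0 => n /Hn H.
have n1 : 0 < n%:R :> R by apply: lt_le_trans H; apply: expR_gt0.
rewrite -[leRHS](@lnK _ delta) ?posrE // ler_expR lerNl.
have : - ln delta / c <= ln n%:R by rewrite -ler_expR lnK // posrE.
by rewrite ler_pdivrMr // mulrC.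
Qed.

(** The logarithm is [O(ln n)] and the denominator at least linear in [n]; the bound
    [ln n <= 2 * sqrt n] suffices. *)
Lemma critical_p_k2 r delta : (1 < r)%N -> 0 < delta -> exists n0, forall n, (n0 <= n)%N ->
  (r * 5 <= n.*2)%N -> critical_p R r n 2 <= delta.
Proof.
move=> r2 d0; have [n0 Hn] := exists_nat_ge ((4 * r.+1%:R / delta) ^+ 2).
exists (maxn n0 (4 * r + 8)) => n; rewrite geq_max => /andP[/Hn nd nr] r5.
have D := critical_degree_ge (k := 2) r2 isT r5; rewrite bin1 in D.
have rn : (0 < r <= n)%N by lia.
have N := star_pairs_le_exp 2 rn; rewrite (_ : (r - 1 + 2 = r.+1)%N) in N; last by lia.
have N0 : (0 < star_pairs r n 2)%N by rewrite muln_gt0 !bin_gt0; lia.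
have n0' : 0 < n%:R :> R by rewrite ltr0n; lia.
set s := Num.sqrt (n%:R : R); have s0 : 0 < s by rewrite sqrtr_gt0.
have ns : n%:R = s ^+ 2 by rewrite sqr_sqrtr // ltW.
have lnn : ln (n%:R : R) <= 2 * s.
  by rewrite ns lnXn // -(mulr_natl (ln _)) ler_wpM2l // ltW // ln_sublinear.
have L : ln ((star_pairs r n 2)%:R : R) <= r.+1%:R * (2 * s).
  apply: (@le_trans _ _ (ln ((n%:R : R) ^+ r.+1))).
    by rewrite ler_ln ?posrE ?ltr0n ?exprn_gt0 // -natrX ler_nat.
  by rewrite lnXn // -(mulr_natl (ln _)) ler_wpM2l.
have Dn : s ^+ 2 <= 2 * (critical_degree r n 2)%:R.
  by rewrite -ns -(natrM R 2) ler_nat; lia.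
have D0 : 0 < (critical_degree r n 2)%:R :> R by rewrite ltr0n; lia.
rewrite critical_pE ler_pdivrMr //; apply: le_trans L _.
move: nd; rewrite ns ler_pXn2r ?nnegrE ?(ltW s0) //; last first.
  by rewrite divr_ge0 ?(ltW d0) // mulr_ge0.
rewrite ler_pdivrMr //; move: Dn s0 d0.
set DD : R := (critical_degree _ _ _)%:R; set rr : R := r.+1%:R => Dn s0 d0 H.
have : s * (4 * rr) <= s * (s * delta) by rewrite ler_wpM2l // ltW.
have : delta * s ^+ 2 <= delta * (2 * DD) by rewrite ler_wpM2l // ltW.
rewrite expr2; lra.
Qed.

(** The logarithm is at most [4 n] and the denominator at least [n ^ 2 / 32]: since
    [r + 2 * k <= n], the index [k - 1] is at distance at least 2 from both ends of its row of
    binomial coefficients. *)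
Lemma critical_p_k3 r delta : (1 < r)%N -> 0 < delta -> exists n0, forall n k, (n0 <= n)%N ->
  (3 <= k)%N -> (r * k.*2.+1 <= n.*2)%N -> (r + 2 * k <= n)%N -> critical_p R r n k <= delta.
Proof.
move=> r2 d0; have [n0 Hn] := exists_nat_ge (128 / delta).
exists (maxn n0 (8 * r + 16)) => n k; rewrite geq_max => /andP[/Hn nd nr] k3 H rk.
have D := critical_degree_ge r2 (ltac:(lia) : (0 < k)%N) H.
have rn : (0 < r <= n)%N by lia.
have N := star_pairs_le_exp4 k rn.
have N0 : (0 < star_pairs r n k)%N by rewrite muln_gt0 !bin_gt0; lia.
have n0' : 0 < n%:R :> R by rewrite ltr0n; lia.
have L : ln ((star_pairs r n k)%:R : R) <= n%:R * 4.
  apply: (@le_trans _ _ (ln ((4 : R) ^+ n))).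
    by rewrite ler_ln ?posrE ?ltr0n ?exprn_gt0 // -natrX ler_nat.
  by rewrite lnXn // -(mulr_natl (ln _)) ler_wpM2l // ltW // ln_sublinear.
have D2 : (n * n <= 32 * critical_degree r n k)%N.
  apply: leq_trans (leq_mul (leqnn 32) D).
  set m := (n - k - (r - 1))%N.
  have nm : (n <= 4 * m.-1)%N by rewrite /m; nia.
  apply: (@leq_trans (32 * 'C(m, 2))); last first.
    rewrite leq_mul2l; apply/orP; right.
    have [k2|k2] := leqP (2 * (k - 1)) m.+1; first by apply: leq_bin2r; lia.
    rewrite -(@bin_sub m (k - 1)); last by rewrite /m; lia.
    by apply: leq_bin2r; rewrite /m in k2 *; lia.
  have := bin_ffact m 2; rewrite (_ : 2`! = 2)%N // ffactnSr ffactn1 => Eb.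
  have : (m.-1 * m.-1 <= m * (m - 1))%N by nia.
  nia.
have D0 : 0 < (critical_degree r n k)%:R :> R.
  by rewrite ltr0n; case: critical_degree D2 => //; nia.
rewrite critical_pE ler_pdivrMr //; apply: le_trans L _.
move: D2; rewrite -(ler_nat R) (natrM R n) (natrM R 32) => D2.
move: nd; rewrite ler_pdivrMr // => nd.
move: D2 nd n0' d0; set DD : R := (critical_degree _ _ _)%:R; set nn : R := n%:R => D2 nd n0' d0.
have : nn * 128 <= nn * (nn * delta) by rewrite ler_wpM2l // ltW.
have : delta * (nn * nn) <= delta * (32 * DD) by rewrite ler_wpM2l // ltW.
lra.
Qed.

(** When [n < r + 2 k], only [r = 2] and [n = 2 k + 1] remain. The denominator is then [k] while
    [star_pairs] is at least [4 ^ k], so the quotient is at least [ln 4]. *)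
Lemma critical_p_dichotomy r delta : (1 < r)%N -> 0 < delta ->
  exists n0, forall n k, (n0 <= n)%N -> (2 <= k)%N -> (r * k.*2.+1 <= n.*2)%N ->
  critical_p R r n k <= delta \/ 1 < critical_p R r n k.
Proof.
move=> r2 d0.
have [n1 H1] := critical_p_k2 r2 d0; have [n2 H2] := critical_p_k3 r2 d0.
exists (maxn n1 n2) => n k; rewrite geq_max => /andP[/H1{}H1 nn2] k2 H.
have [k3|k3] := ltnP 2 k; last first.
  left; have Ek : k = 2 by lia.
  by rewrite Ek in H *; apply: H1.
have [rk|rk] := leqP (r + 2 * k) n; first by left; apply: H2.
right; have Er : r = 2 by nia.
have En : n = (2 * k).+1 by rewrite Er in H rk; lia.
rewrite critical_pE Er En.
have -> : critical_degree 2 (2 * k).+1 k = k.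
  rewrite /critical_degree big_nat1 mul1n.
  have -> : ((2 * k).+1 - k - (2 - 1) = k)%N by lia.
  rewrite subn1 -[in 'C(k, _)](@prednK k) /=; last by lia.
  by rewrite binSn prednK //; lia.
have -> : star_pairs 2 (2 * k).+1 k = ((2 * k).+1 * 'C(2 * k, k))%N.
  by rewrite /star_pairs bin1; congr (_ * 'C(_, _))%N; lia.
have k0 : 0 < k%:R :> R by rewrite ltr0n; lia.
rewrite ltr_pdivlMr // mul1r.
apply: (@lt_le_trans _ _ (ln ((4 : R) ^+ k))); last first.
  rewrite ler_ln ?posrE ?exprn_gt0 // ?ltr0n ?muln_gt0 ?bin_gt0; [|by lia].
  by rewrite -natrX ler_nat four_pow_le_central.
rewrite lnXn // -(mulr_natr (ln _)) -{1}[k%:R]mul1r ltr_pM2r //.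
rewrite -ltr_expR lnK ?posrE //.
(* This gives [expR (1 / 2) < 2], hence [expR 1 < 4]. *)
have e2 : expR (- (1 / 2)) > 1 / 2 :> R.
  by apply: le_lt_trans (expR_gt1Dx _); lra.
have : expR (- (1 / 2)) * expR (1 / 2) = 1 :> R by rewrite -expRD addNr expR0.
have -> : expR (1 : R) = expR (1 / 2) * expR (1 / 2).
  by rewrite -expRD; congr expR; lra.
have := expR_gt0 (1 / 2 : R).
move: e2; set a := expR (- _); set b := expR _ => e2 b0 E.
have b2 : b < 2 by nra.
nra.
Qed.

End Asymptotics.

(** * Vanishing probability below the threshold *)

Section Subcritical.
Variable R : realType.
Implicit Types (p eps delta : R) (n r k : nat).

(** Passing from [p] to [- ln (1 - p)] worsens [1 - eps] to [1 - eps / 2]. This is enough when [c],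
    and so [p], is small; when [c > 1] the bound assumed on [p] is already in exponential form. *)
Lemma one_sub_expr_ge eps p c D (L : R) : 0 < eps <= 1 -> 0 <= p <= 1 -> 0 <= L ->
  (0 < D)%N -> c = L / D%:R ->
  p <= (1 - eps) * c -> (1 < c -> p <= 1 - expR (- ((1 - eps) * c))) ->
  c <= eps / 2 \/ 1 < c ->
  p < 1 /\ expR (- ((1 - eps / 2) * L)) <= (1 - p) ^+ D.
Proof.
move=> e01 p01 L0 D0 cE pc pc1 Hc.
have DR : 0 < D%:R :> R by rewrite ltr0n.
have LE : L = c * D%:R by rewrite cE divfK // gt_eqF.
have c0 : 0 <= c by rewrite cE divr_ge0 // ltW.
suff [t [tq tc]] : exists t, expR (- t) <= 1 - p /\ t <= (1 - eps / 2) * c.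
  have := expR_gt0 (- t) => et; split; first by lra.
  apply: (@le_trans _ _ (expR (- t) ^+ D)).
    rewrite -expRM_natr ler_expR LE mulrA -mulNr ler_wpM2r ?(ltW DR) //; lra.
  by apply: lerXn2r; rewrite ?nnegrE ?expR_ge0 //; lra.
case: Hc => [ce|c1]; last first.
  exists ((1 - eps) * c); split; first by have := pc1 c1; lra.
  by apply: ler_wpM2r => //; lra.
have p2 : p <= eps / 2 by nra.
have q0 : 0 < 1 - p by lra.
(* This bounds [- ln (1 - p)] from above, and [1 - eps <= (1 - eps / 2) ^ 2 <= (1 - eps / 2) * (1 -
   p)]. *)
exists (p / (1 - p)); split.
  have H : 1 + p / (1 - p) <= expR (p / (1 - p)) by apply: expR_ge1Dx.
  have E : 1 + p / (1 - p) = (1 - p)^-1 by field; rewrite gt_eqF.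
  by rewrite expRN -[leRHS]invrK lef_pV2 ?posrE ?expR_gt0 ?invr_gt0 //; rewrite E in H.
rewrite ler_pdivrMr //.
apply: (le_trans pc).
have e2 : 1 - eps <= (1 - eps / 2) * (1 - eps / 2) by nra.
have e3 : (1 - eps / 2) * (1 - eps / 2) <= (1 - eps / 2) * (1 - p) by nra.
rewrite -mulrA [c * _]mulrC mulrA ler_wpM2r //; lra.
Qed.

(* Restricting centers to half of the ground set and sets to the other half loses
   only a constant factor in [star_pairs] when [k] is bounded. *)
Lemma pair_count_small r K : (1 < r)%N -> exists n0, forall n k, (n0 <= n)%N ->
  (0 < k <= K)%N -> (star_pairs r n k <=
   (4 ^ (r - 1) * (r - 1)`! * (4 ^ K * K`!)) * ('C(n./2, r.-1) * 'C(n - n./2, k)))%N.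
Proof.
move=> r2; exists (4 * r + 4 * K + 4)%N => n k nn kK.
have rn : (0 < r <= n)%N by lia.
apply: leq_trans (star_pairs_le_exp k rn) _.
rewrite expnD mulnACA; apply: leq_mul; rewrite -?subn1.
  rewrite -mulnA [((r - 1)`! * _)%N]mulnC.
  apply: leq_trans (leq_mul (leqnn _) (exp_le_bin_fact _ _)).
  by rewrite -expnMn; apply: leq_expl; lia.
apply: (@leq_trans (4 ^ k * k`! * 'C(n - n./2, k))).
  rewrite -mulnA [(k`! * _)%N]mulnC.
  apply: leq_trans (leq_mul (leqnn _) (exp_le_bin_fact _ _)).
  by rewrite -expnMn; apply: leq_expl; lia.
rewrite leq_mul2r; apply/orP; right; apply: leq_mul.
  by rewrite leq_exp2l //; lia.
by apply: leq_fact; lia.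
Qed.

(** The coefficient of index [2 * h] is of order [n ^ (2 * h)]; the surplus [n ^ h] absorbs the
    constants. *)
Lemma bin_ge_exp r h : (1 < r)%N -> (0 < h)%N -> exists n0, forall n k, (n0 <= n)%N ->
  (2 * h <= k)%N -> (2 * k <= (n - r + 1).+1)%N -> (n ^ h <= 'C(n - r + 1, k))%N.
Proof.
move=> r2 h0; exists (4 * (2 * h)`! + 2 * (r + 2 * h))%N => n k nn hk kn.
apply: leq_trans (leq_bin2r hk kn).
have f0 : (0 < (2 * h)`!)%N by apply: fact_gt0.
rewrite -(leq_pmul2r f0); apply: leq_trans (exp_le_bin_fact _ _).
apply: (@leq_trans ((n * (2 * h)`!) ^ h)).
  rewrite expnMn leq_mul2l; apply/orP; right.
  by rewrite -{1}(expn1 (2 * h)`!) leq_pexp2l.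
rewrite expnM; apply: leq_expl; rewrite -mulnn.
set m := (n - r + 1 - 2 * h)%N; have nm : (n <= 2 * m)%N by rewrite /m; lia.
have : (4 * (2 * h)`! <= n)%N by lia.
move: (_`!) => z nz; nia.
Qed.

Lemma ln_star_pairs_ge0 r n k : (0 < r)%N -> (r + k <= n)%N ->
  0 <= ln (star_pairs r n k)%:R :> R.
Proof.
move=> r0 rk; rewrite ln_ge0 // ler1n muln_gt0 !bin_gt0; lia.
Qed.

(** A single center is enough: the bound is at most ['C(n, r - 1) * N ^ (- eps / 2)] with
    [N = star_pairs r n k], and for large [k] the power of [N] beats [n ^ (r - 1)]. *)
Lemma subcritical_large_k eps delta r : (1 < r)%N -> 0 < eps <= 1 -> 0 < delta ->
  exists K n0, forall n k p, (n0 <= n)%N -> (K <= k)%N -> (r * k.*2.+1 <= n.*2)%N ->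
    0 <= p < 1 ->
    expR (- ((1 - eps / 2) * ln (star_pairs r n k)%:R)) <= (1 - p) ^+ critical_degree r n k ->
    random_kneser_pr r n k p (alpha_is_star_size r n k) <= delta.
Proof.
move=> r2 e01 d0; have e0 : 0 < eps by lra.
(* As [N >= n ^ h.+1] and [h.+1 >= 2 * r / eps], the factor [N ^ (- eps / 2)] is at most
   [n ^ (- r)], leaving [1 / n] in the end. *)
have [h Hh] := exists_nat_ge (2 * r%:R / eps).
have {}Hh := Hh h.+1 (leqnSn h).
have [n1 H1] := bin_ge_exp r2 (ltn0Sn h).
have [n2 H2] := expR_ln_small (ltr01 : 0 < 1 :> R) d0.
exists (2 * h.+1)%N, (maxn n1 (maxn n2 2)) => n k p.
rewrite !geq_max => /and3P[n1n n2n nn2] Kk H p01 Hq.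
have rk : (r + k <= n)%N by nia.
have k2 : (2 * k <= (n - r + 1).+1)%N by nia.
have HC := H1 n k n1n Kk k2.
have n_gt0 : (0 < n)%N by lia.
have C_gt0 : (0 < 'C(n - r + 1, k))%N by rewrite bin_gt0; lia.
have S_gt0 : (0 < 'C(n, r - 1))%N by rewrite bin_gt0; lia.
have En : (n - r.-1 = n - r + 1)%N by lia.
have k_gt0 : (0 < k)%N by lia.
have rkn : (r.-1 + k <= n)%N by lia.
have := @alpha_is_star_size_pr_le r n k r2 k_gt0 rk R p 0 r.-1 p01 (lexx 0)
  (leqnn _) rkn _.
rewrite ltnn => /(_ (fun w => ltac:(done))) Hp; apply: le_trans Hp _.
rewrite mul0r addr0 binn mul1r.
rewrite En.
set q := (1 - p) ^+ _ in Hq *; set L := ln _ in Hq.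
have n0 : 0 < n%:R :> R by rewrite ltr0n.
have C0 : 0 < 'C(n - r + 1, k)%:R :> R.
  by rewrite ltr0n.
have q0 : 0 < q by apply: lt_le_trans Hq; apply: expR_gt0.
have S0 : 0 < 'C(n, r - 1)%:R :> R by rewrite ltr0n.
have N0 : 0 < (star_pairs r n k)%:R :> R by rewrite natrM mulr_gt0.
have EL : expR L = 'C(n, r - 1)%:R * 'C(n - r + 1, k)%:R.
  by rewrite /L lnK ?posrE // natrM.
have Ln : h.+1%:R * ln n%:R <= L.
  rewrite mulr_natl -lnXn // /L ler_ln ?posrE ?exprn_gt0 //.
  rewrite -natrX ler_nat; apply: leq_trans HC _; by rewrite leq_pmull.
have ln0 : 0 <= ln (n%:R : R) by rewrite ln_ge0 // ler1n.
have Sn : 'C(n, r - 1)%:R <= expR ((r%:R - 1) * ln n%:R) :> R.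
  apply: (@le_trans _ _ (n%:R ^+ (r - 1))); first by rewrite -natrX ler_nat bin_le_exp.
  by rewrite -{1}(@lnK _ n%:R) ?posrE // -expRM_natl natrB // ltnW.
have {}H2 := H2 n n2n; apply: (le_trans _ H2).
rewrite invfM.
apply: (@le_trans _ _ ('C(n - r + 1, k)%:R^-1 * expR ((1 - eps / 2) * L))).
  rewrite ler_wpM2l ?invr_ge0 ?(ltW C0) // -[leRHS]invrK -expRN lef_pV2 ?posrE ?expR_gt0 //.
have -> : (1 - eps / 2) * L = L + - (eps / 2 * L) by ring.
rewrite expRD EL mulrA mulrCA mulVf ?gt_eqF // mulr1.
apply: (@le_trans _ _ (expR ((r%:R - 1) * ln n%:R) * expR (- (eps / 2 * L)))).
  by rewrite ler_wpM2r // ltW // expR_gt0.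
rewrite -expRD ler_expR mul1r.
have : eps / 2 * (h.+1%:R * ln n%:R) <= eps / 2 * L by rewrite ler_wpM2l //; lra.
have : 2 * r%:R <= h.+1%:R * eps by rewrite -ler_pdivrMr.
move: ln0; set l := ln n%:R; move: Hh => _; set hh : R := h.+1%:R; set rr : R := r%:R.
move=> l0 Hhe Hl.
have : l * (2 * rr) <= l * (hh * eps) by rewrite ler_wpM2l.
lra.
Qed.

(** With [U] half of the ground set, the available pairs are a constant fraction of [star_pairs], so
    the first term is [O(N ^ (- eps / 2))]. Distinct centers share a fraction [O(1 / n)] of their
    edges, which keeps the second term small. *)
Lemma subcritical_small_k eps delta r K : (1 < r)%N -> 0 < eps <= 1 -> 0 < delta ->
  exists n0, forall n k p, (n0 <= n)%N -> (0 < k <= K)%N ->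
    0 <= p < 1 ->
    expR (- ((1 - eps / 2) * ln (star_pairs r n k)%:R)) <= (1 - p) ^+ critical_degree r n k ->
    random_kneser_pr r n k p (alpha_is_star_size r n k) <= delta.
Proof.
move=> r2 e01 d0; have e0 : 0 < eps by lra.
have [n1 H1] := @pair_count_small r K r2.
set B := (4 ^ (r - 1) * (r - 1)`! * (4 ^ K * K`!))%N in H1.
have B0 : 0 < B%:R :> R by rewrite ltr0n !muln_gt0 !expn_gt0 !fact_gt0.
have [n2 H2] := @expR_ln_small R (eps / 2) (delta / (2 * B%:R)) ltac:(lra) ltac:(by rewrite divr_gt0 // mulr_gt0).
have [n3 H3] := @expR_ln_small R (1 / 2) (delta / 4) ltac:(lra) ltac:(lra).
exists (maxn (maxn n1 n2) (maxn n3 (4 * r + 4 * K + 4 + 2 * (r + K) * (r * K)))) => n k p.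
rewrite !geq_max => /andP[/andP[n1n n2n] /andP[n3n nr]] kK p01 Hq.
have rk : (r + k <= n)%N by lia.
have n_gt0 : (0 < n)%N by lia.
have k_gt0 : (0 < k)%N by case/andP: kK.
have ru : (r.-1 <= n./2)%N by lia.
have uk : (n./2 + k <= n)%N by lia.
have N_gt0 : (0 < star_pairs r n k)%N.
  by rewrite muln_gt0 !bin_gt0; apply/andP; split; lia.
have rn : (0 < r <= n)%N by lia.
have rkK : (r - 1 + k <= r + K)%N by lia.
have Hn : (2 * ((r + K) * (r.-1 * k.-1)) <= n - r.-1 - k)%N.
  have : ((r + K) * (r.-1 * k.-1) <= (r + K) * (r * K))%N.
    by rewrite leq_mul2l leq_mul ?orbT //; lia.
  by move: nr; rewrite -mulnA; lia.
have M_gt0 : (0 < n - r.-1 - k)%N by lia.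
have kh : (0 < k < n - n./2)%N by lia.
have kn : (0 < k < n)%N by lia.
have nh : (n <= 2 * (n - n./2))%N by lia.
(* [L] is the square root of [n]: missing all [D] edges costs at most a factor [n ^ (r + K)], so
   missing a fraction [O(1 / n)] of them costs at most [sqrt n], while the second half carries at
   least [n / 2] k-sets. *)
set L := expR (1 / 2 * ln (n%:R : R)).
have n0 : 0 < n%:R :> R by rewrite ltr0n.
have ln0 : 0 <= ln (n%:R : R) by rewrite ln_ge0 // ler1n.
have q0 : 0 < 1 - p by lra.
have N0 : 0 < (star_pairs r n k)%:R :> R.
  by rewrite ltr0n.
have := @alpha_is_star_size_pr_le r n k r2 k_gt0 rk R p L n./2 p01
  (ltW (expR_gt0 _)) ru uk _.
have HL w : (r.-1 < n./2)%N ->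
   (w * (n - r.-1 - k) <= critical_degree r n k * (r.-1 * k.-1))%N ->
   1 <= (1 - p) ^+ w * L.
  move=> _ Hw; rewrite -{1}(@lnK _ (1 - p)) ?posrE // -expRM_natl -expRD -[leLHS]expR0 ler_expR.
  have lnN : ln (star_pairs r n k)%:R <= (r + K)%:R * ln n%:R :> R.
    rewrite mulr_natl -lnXn // ler_ln ?posrE ?exprn_gt0 // -natrX ler_nat.
    by apply: leq_trans (star_pairs_le_exp _ rn) _; rewrite leq_pexp2l.
  have lnN0 : 0 <= ln (star_pairs r n k)%:R :> R by rewrite ln_ge0 // ler1n.
  have tD : - ln (1 - p) * (critical_degree r n k)%:R <= (r + K)%:R * ln n%:R.
    apply: le_trans lnN; rewrite mulNr lerNl mulrC mulr_natl -lnXn // -ler_expR.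
    rewrite lnK ?posrE ?exprn_gt0 //; apply: le_trans Hq.
    by rewrite ler_expR; nra.
  have t0 : 0 <= - ln (1 - p).
    by rewrite oppr_ge0 -ler_expR lnK ?posrE // expR0; lra.
  have M0 : 0 < (n - r.-1 - k)%:R :> R by rewrite ltr0n.
  move: Hw (Hn); rewrite -!(ler_nat R) (natrM R w) (natrM R (critical_degree _ _ _)) (natrM R 2) (natrM R (r + K)).
  move: tD t0 M0 ln0; set t := - ln (1 - p); have -> : ln (1 - p) = - t by rewrite opprK.
  set l := ln n%:R; set M : R := (n - _ - _)%:R; set D : R := (critical_degree _ _ _)%:R.
  set c : R := (r.-1 * _)%:R; set b : R := (r + K)%:R; set ww : R := w%:R => tD t0 M0 l0 H5 H6.
  have c0 : 0 <= c by rewrite ler0n.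
  rewrite mulrN addrC subr_ge0 -(ler_pM2r M0).
  apply: (@le_trans _ _ (t * (D * c))).
    have -> : ww * t * M = t * (ww * M) by ring.
    by rewrite ler_wpM2l.
  apply: (@le_trans _ _ ((b * l) * c)).
    by rewrite [t * (D * c)]mulrA ler_wpM2r.
  have : l * (2 * (b * c)) <= l * M by rewrite ler_wpM2l.
  lra.
move=> /(_ HL) Hp; apply: le_trans Hp _.
have Ch : (n <= 2 * 'C(n - n./2, k))%N.
  apply: leq_trans (leq_mul (leqnn 2) (leq_bin kh)).
  exact: nh.
have {}H1 := H1 n k n1n kK; have {}H2 := H2 n n2n; have {}H3 := H3 n n3n.
have C2 : (0 < 'C(n - n./2, k))%N by rewrite bin_gt0 ltnW //; case/andP: kh.
have C1 : (0 < 'C(n./2, r.-1))%N by rewrite bin_gt0.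
have P0 : 0 < 'C(n./2, r.-1)%:R * 'C(n - n./2, k)%:R :> R.
  by rewrite mulr_gt0 ?ltr0n.
set q := (1 - p) ^+ _ in Hq *; have qq0 : 0 < q by apply: exprn_gt0.
have lnN : ln (n%:R : R) <= ln (star_pairs r n k)%:R.
  rewrite ler_ln ?posrE // ler_nat.
  by apply: leq_trans (bin_le_star_pairs _ rk); [apply: leq_bin | case/andP: rn].
have T1 : ('C(n./2, r.-1)%:R * 'C(n - n./2, k)%:R * q)^-1 <= delta / 2.
  move: H1; rewrite -(ler_nat R) (natrM R B) (natrM R 'C(_, _)).
  move: P0; set P : R := _%:R * _%:R => P0 H1.
  apply: (@le_trans _ _ (P^-1 * expR ((1 - eps / 2) * ln (star_pairs r n k)%:R))).
    rewrite invfM ler_wpM2l ?invr_ge0 ?(ltW P0) //.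
    by rewrite -[leRHS]invrK -expRN lef_pV2 ?posrE ?expR_gt0.
  rewrite mulrC ler_pdivrMr //.
  have -> : (1 - eps / 2) * ln (star_pairs r n k)%:R =
     ln (star_pairs r n k)%:R + - (eps / 2 * ln (star_pairs r n k)%:R) :> R by ring.
  rewrite expRD lnK ?posrE //.
  apply: (@le_trans _ _ (B%:R * P * (delta / (2 * B%:R)))); last first.
    by rewrite le_eqVlt; apply/orP; left; apply/eqP; field; rewrite gt_eqF.
  apply: ler_pM => //; rewrite ?(ltW N0) ?expR_ge0 //.
  apply: le_trans H2; rewrite ler_expR lerN2 ler_wpM2l //; lra.
have T2 : L / 'C(n - n./2, k)%:R <= delta / 2.
  have C2R : 0 < 'C(n - n./2, k)%:R :> R by rewrite ltr0n.
  rewrite ler_pdivrMr //.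
  have EL : L * L = n%:R.
    by rewrite /L -expRD -mulrDl (_ : 1 / 2 + 1 / 2 = 1) ?mul1r ?lnK ?posrE //; lra.
  have LV : L * expR (- (1 / 2 * ln n%:R)) = 1 by rewrite /L -expRD subrr expR0.
  move: Ch; rewrite -(ler_nat R) (natrM R 2) -EL.
  have L0 : 0 < L by apply: expR_gt0.
  move: H3 LV; set v := expR (- _) => H3 LV Ch.
  have : L * v <= L * (delta / 4) by rewrite ler_wpM2l // ltW.
  rewrite LV => H4.
  have : L * 1 <= L * (L * (delta / 4)) by rewrite ler_wpM2l // ltW.
  have : (L * L) * (delta / 4) <= 2 * 'C(n - n./2, k)%:R * (delta / 4).
    by rewrite ler_wpM2r //; lra.
  lra.
by move: T1 T2; lra.
Qed.

Lemma subcritical_pr eps delta r : (1 < r)%N -> 0 < eps <= 1 -> 0 < delta ->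
  exists n0, forall n k p, (n0 <= n)%N -> (2 <= k)%N -> (r * k.*2.+1 <= n.*2)%N ->
    0 <= p <= 1 -> p <= (1 - eps) * critical_p R r n k ->
    (1 < critical_p R r n k -> p <= 1 - expR (- ((1 - eps) * critical_p R r n k))) ->
    random_kneser_pr r n k p (alpha_is_star_size r n k) <= delta.
Proof.
move=> r2 e01 d0.
(* The large case yields the value [K] up to which the bounded case is invoked. *)
have [K [n1 H1]] := subcritical_large_k r2 e01 d0.
have [n2 H2] := @subcritical_small_k eps delta r K r2 e01 d0.
have [n3 H3] := @critical_p_dichotomy R r (eps / 2) r2 ltac:(lra).
exists (maxn n1 (maxn n2 n3)) => n k p; rewrite !geq_max => /and3P[nn1 nn2 nn3] k2 H p01 pc pc1.
have rk : (r + k <= n)%N by nia.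
have D0 : (0 < critical_degree r n k)%N.
  apply: leq_trans (critical_degree_ge r2 _ H); last by lia.
  rewrite bin_gt0; nia.
have [p1 Hq] := one_sub_expr_ge e01 p01 (ln_star_pairs_ge0 (ltnW r2) rk) D0
  (critical_pE R r n k) pc pc1 (H3 n k nn3 k2 H).
have p01' : 0 <= p < 1 by case/andP: p01 => -> _.
have [kK|/ltnW Kk] := leqP k K; last exact: H1.
by apply: H2; rewrite // kK andbT ltnW.
Qed.

End Subcritical.

(* Passage to the limit *)
From mathcomp Require Import all_classical all_reals all_analysis.
Import numFieldNormedType.Exports.
Local Open Scope classical_set_scope.
Local Open Scope ring_scope.

(** With [a = (24 * r) ^ 3], cubing gives [a * k ^ 3 <= a ^ (- 2) * n], and [a >= 1]. *)
Lemma large_of_root_bound (R : realType) (r n k : nat) : (0 < r)%N -> (0 < n)%N ->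
  k%:R <= ((24 * r) ^ 3)%N%:R^-1 * n%:R `^ 3^-1 :> R -> ((24 * r) ^ 3 * k ^ 3 <= n)%N.
Proof.
move=> r0 n0; have a0 : (0 < (24 * r) ^ 3)%N by rewrite expn_gt0; lia.
move: ((24 * r) ^ 3)%N a0 => a a0 H.
have aR : 1 <= a%:R :> R by rewrite ler1n.
have K3 : (k%:R : R) ^+ 3 <= (a%:R ^-1 * n%:R `^ 3^-1) ^+ 3.
  by apply: lerXn2r H; rewrite nnegrE ?mulr_ge0 ?invr_ge0 ?powR_ge0.
have n3 : (n%:R `^ 3^-1) ^+ 3 = n%:R :> R.
  by rewrite -powR_mulrn ?powR_ge0 // -powRrM mulVf ?powRr1 // pnatr_eq0.
rewrite -(ler_nat R) natrM natrX.
apply: (@le_trans _ _ (a%:R * (a%:R^-1 * n%:R `^ 3^-1) ^+ 3)).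
  by rewrite ler_wpM2l.
rewrite exprMn n3 mulrA ler_piMl // exprSr mulrCA divff ?gt_eqF ?(lt_le_trans _ aR) //.
by rewrite mulr1 exprVn invf_le1 ?exprn_ege1 // exprn_gt0 // (lt_le_trans _ aR).
Qed.

Theorem theorem1 (R : realType) (r : nat) (hr : (2 <= r)%N) :
  (exists zeta C : R, [/\ 0 < zeta, 0 < C &
     forall (k : nat -> nat) (p : nat -> R),
       (\forall n \near \oo, (2 <= k n)%N) ->
       (\forall n \near \oo, r%:R * ((k n)%:R + 2^-1) <= n%:R :> R) ->
       (\forall n \near \oo, 0 <= p n <= 1) ->
       (\forall n \near \oo, zeta * critical_p R r n (k n) < p n) ->
       (\forall n \near \oo, (k n)%:R <= C * n%:R `^ 7^-1) \/
         ((r = 2%N \/ r = 3%N) /\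
          (fun n => (k n)%:R : R) =o_\oo (fun n => n%:R `^ 3^-1 : R)) ->
       (random_kneser_pr r n (k n) (p n) (alpha_is_star_size r n (k n))
          @[n --> \oo] --> (1 : R)) /\
       (random_kneser_pr r n (k n) (p n) (only_star_unions r n (k n))
          @[n --> \oo] --> (1 : R))])
  /\
  (forall (eps : R) (k : nat -> nat) (p : nat -> R),
     0 < eps <= 1 ->
     (\forall n \near \oo, (2 <= k n)%N) ->
     (\forall n \near \oo, r%:R * ((k n)%:R + 2^-1) <= n%:R :> R) ->
     (\forall n \near \oo, 0 <= p n <= 1) ->
     (\forall n \near \oo, p n <= (1 - eps) * critical_p R r n (k n)) ->
     (* When critical_p > 1 the previous bound no longer restricts p; see n = 2k+1, r = 2. *)
     (\forall n \near \oo, 1 < critical_p R r n (k n) ->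
        p n <= 1 - expR (- ((1 - eps) * critical_p R r n (k n)))) ->
     random_kneser_pr r n (k n) (p n) (alpha_is_star_size r n (k n))
       @[n --> \oo] --> (0 : R)).
Proof.
split.
  pose a := ((24 * r) ^ 3)%N.
  have a0 : (0 < a)%N by rewrite /a expn_gt0; lia.
  (* [zeta] is the constant required by the union bound, and [C] the one in
     [large_of_root_bound]. *)
  exists (6 * (Gamma r)%:R), (a%:R^-1); split.
  - by rewrite mulr_gt0 // ltr0n /Gamma muln_gt0 expn_gt0; lia.
  - by rewrite invr_gt0 ltr0n.
  move=> k p Hk _ Hp Hc Hkn.
  have Hlarge : \forall n \near \oo, (a * k n ^ 3 <= n)%N.
    (* Either growth condition gives [k <= a^-1 * n ^ (1/3)] eventually: the first because
       [n ^ (1/7) <= n ^ (1/3)], the second by taking [a^-1] as the constant of the little-o. *)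
    case: Hkn => [H7|[_ /eqoP Ho]].
      near=> n; apply: (@large_of_root_bound R) => //; first exact: ltnW.
        by near: n; exact: nbhs_infty_gt.
      apply: le_trans (_ : a%:R^-1 * n%:R `^ 7^-1 <= _); first by near: n.
      rewrite ler_wpM2l ?invr_ge0 // ler_powR //.
        by rewrite ler1n; near: n; exact: nbhs_infty_gt.
      by rewrite lef_pV2 ?posrE // ler_nat.
    have aV : 0 < a%:R^-1 :> R by rewrite invr_gt0 ltr0n.
    have {}Ho := Ho _ aV.
    near=> n; apply: (@large_of_root_bound R) => //; first exact: ltnW.
      by near: n; exact: nbhs_infty_gt.
    have : `|(k n)%:R : R| <= a%:R^-1 * `|n%:R `^ 3^-1 : R| by near: n.
    by rewrite !ger0_norm // powR_ge0.
  have only (e : R) : 0 < e -> \forall n \near \oo,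
      1 - e <= random_kneser_pr r n (k n) (p n) (only_star_unions r n (k n)) /\
      random_kneser_pr r n (k n) (p n) (only_star_unions r n (k n)) <=
      random_kneser_pr r n (k n) (p n) (alpha_is_star_size r n (k n)) <= 1.
    move=> e0; have [n0 Hn0] := exists_nat_ge (2 / e).
    near=> n.
    have k2 : (2 <= k n)%N by near: n.
    have nk : (a * k n ^ 3 <= n)%N by near: n.
    have p01 : 0 <= p n <= 1 by near: n.
    have pc : 6 * (Gamma r)%:R * critical_p R r n (k n) < p n by near: n.
    have ne : 2 / e <= n%:R by apply: Hn0; near: n; exact: nbhs_infty_ge.
    split; last first.
      by rewrite alpha_is_star_size_pr //=; exact: random_subset_pr_le1.
    apply: le_trans (only_star_unions_pr hr k2 nk p01 pc).
    have n0R : 0 < n%:R :> R by apply: lt_le_trans ne; rewrite divr_gt0.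
    by rewrite lerD2l lerN2 ler_pdivrMr // mulrC -ler_pdivrMr.
  split; apply/cvgrPdist_le => e e0;
      apply: filterS (only e e0) => n [H1 /andP[H2 H3]].
    by rewrite ger0_norm ?subr_ge0 // lerBlDl -lerBlDr (le_trans H1).
  by rewrite ger0_norm ?subr_ge0 ?(le_trans H2) // lerBlDl -lerBlDr.
move=> eps k p e01 Hk Hn Hp Hc Hc1.
apply/cvgrPdist_le => e e0; have [n0 Hn0] := subcritical_pr hr e01 e0.
near=> n; have p01 : 0 <= p n <= 1 by near: n.
rewrite sub0r normrN ger0_norm //; last exact: random_subset_pr_ge0.
apply: Hn0 => //; try by near: n.
  by near: n; exact: nbhs_infty_ge.
(* Doubling both sides gives the integer form [r * (k n).*2.+1 <= n.*2]. *)
have : r%:R * ((k n)%:R + 2^-1) <= n%:R :> R by near: n.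
have E m : m.*2%:R = 2 * m%:R :> R by rewrite -muln2 natrM mulrC.
rewrite -(ler_nat R) natrM -[(k n).*2.+1%:R]natr1 !E.
move: (r%:R : R) ((k n)%:R : R) (n%:R : R) => x y z; lra.
Unshelve. all: by end_near.
Qed.
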